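(* For every $\Sigma^1_1$ set $P \subseteq \mathbb{N}$ there exist a finite alphabet $S$ and a cellular automaton $f$ on the full shift $S^{\mathbb{Z}}$ such that $P$ is many-one reducible to the language of the asymptotic set $\mathcal{A}(f)$. In particular, there exists a cellular automaton on a full shift whose asymptotic set has a $\Sigma^1_1$-complete language.
   Context: A cellular automaton on $X = S^{\mathbb{Z}}$ ($S$ finite, product topology) is a continuous map $f: X\to X$ commuting with the shift. The asymptotic set of $f$ is $\mathcal{A}(f) = \bigcup_{x \in X} \bigcap_{n \in \mathbb{N}} \overline{\bigcup_{k \geq n} \{f^k(x)\}}$. The language of a (not necessarily closed) set $Y \subseteq S^{\mathbb{Z}}$ is the set of words $w \in S^*$ with $w = y_{[0,k-1]}$ for some $y \in Y$, $k \in \mathbb{N}$; it is viewed as a subset of $\mathbb{N}$ via a computable bijection $S^* \cong \mathbb{N}$. A set $P \subseteq \mathbb{N}$ is $\Sigma^1_1$ if $w \in P \iff (\exists C \subseteq \mathbb{N})(\forall m \in \mathbb{N})(\exists \ell \in \mathbb{N}) R(C,m,\ell,w)$ for some recursive predicate $R$; it is $\Sigma^1_1$-complete if it is $\Sigma^1_1$ and every $\Sigma^1_1$ set many-one (computably) reduces to it. *)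

(* Defs.v *)
From Stdlib Require Import ZArith.
From mathcomp Require Import all_boot.
Set Implicit Arguments. Unset Strict Implicit. Unset Printing Implicit Defensive.

(* Arguments are given as a list of naturals; missing arguments read as 0. *)
Inductive rfun : Type :=
| RZero
| RSucc
| RProj (i : nat)
| ROracle
| RComp (g : rfun) (hs : list rfun)
| RPrimRec (b s : rfun)
| RMu (g : rfun).

Inductive reval (C : nat -> bool) : rfun -> seq nat -> nat -> Prop :=
| ev_zero v : reval C RZero v 0
| ev_succ v : reval C RSucc v (head 0 v).+1
| ev_proj i v : reval C (RProj i) v (nth 0 v i)
| ev_oracle v : reval C ROracle v (if C (head 0 v) then 1 else 0)
| ev_comp g hs v ws r :
    revals C hs v ws -> reval C g ws r -> reval C (RComp g hs) v r
| ev_rec0 b s v r : reval C b v r -> reval C (RPrimRec b s) (0 :: v) r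
| ev_recS b s n v a r :
    reval C (RPrimRec b s) (n :: v) a -> reval C s (n :: a :: v) r ->
    reval C (RPrimRec b s) (n.+1 :: v) r
| ev_recnil b s r : reval C (RPrimRec b s) [:: 0] r ->
    reval C (RPrimRec b s) [::] r
| ev_mu g v n :
    reval C g (n :: v) 0 ->
    (forall m, m < n -> exists2 r, reval C g (m :: v) r & r <> 0) ->
    reval C (RMu g) v n
with revals (C : nat -> bool) : list rfun -> seq nat -> seq nat -> Prop :=
| evs_nil v : revals C nil v [::]
| evs_cons h hs v w ws :
    reval C h v w -> revals C hs v ws -> revals C (cons h hs) v (w :: ws).

Definition computable (g : nat -> nat) : Prop :=
  exists e : rfun, forall n, reval (fun _ => false) e [:: n] (g n).

Definition many_one_reducible (P Q : nat -> Prop) : Prop :=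
  exists g, computable g /\ forall w, P w <-> Q (g w).

(* Sigma^1_1: w \in P <-> exists C, forall m, exists l, R(C,m,l,w), with R
   a recursive predicate (an oracle program total for every oracle; R holds
   iff the output is 0). *)
Definition Sigma11 (P : nat -> Prop) : Prop :=
  exists e : rfun,
    (forall (C : nat -> bool) m l w, exists r, reval C e [:: m; l; w] r) /\
    (forall w, P w <-> exists C : nat -> bool, forall m, exists l,
        reval C e [:: m; l; w] 0).

Definition Sigma11_complete (P : nat -> Prop) : Prop :=
  Sigma11 P /\ forall Q, Sigma11 Q -> many_one_reducible Q P.

Definition config (S : Type) := Z -> S.

Definition shift (S : Type) (x : config S) : config S := fun i => x (i + 1)%Z.

Definition agree_on (S : Type) (m : nat) (x y : config S) : Prop :=
  forall i : Z, (Z.abs i <= Z.of_nat m)%Z -> x i = y i.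

(* continuity for the product topology on S^Z (S discrete) *)
Definition cont_prod (S : Type) (f : config S -> config S) : Prop :=
  forall (x : config S) (n : nat), exists m : nat,
    forall y : config S, agree_on m y x -> agree_on n (f y) (f x).

Definition cellular_automaton (S : Type) (f : config S -> config S) : Prop :=
  cont_prod f /\ forall x i, f (shift x) i = shift (f x) i.

Definition omega_limit (S : Type) (f : config S -> config S) (x y : config S)
  : Prop :=
  forall n m : nat, exists k : nat, n <= k /\ agree_on m (iter k f x) y.

Definition asymptotic_set (S : Type) (f : config S -> config S) (y : config S)
  : Prop := exists x, omega_limit f x y.

Definition language (S : Type) (Y : config S -> Prop) (w : seq S) : Prop :=
  exists y, Y y /\ w = map (fun i => y (Z.of_nat i)) (iota 0 (size w)).

(* computable bijection S^* ~ N: bijective base-#|S| numeration,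
   letter a has digit (enum_rank a).+1, least significant digit first *)
Fixpoint word_code (S : finType) (w : seq S) : nat :=
  match w with
  | [::] => 0
  | a :: w' => (enum_rank a).+1 + #|S| * word_code w'
  end.

Definition languageN (S : finType) (Y : config S -> Prop) (n : nat) : Prop :=
  exists w : seq S, word_code w = n /\ language Y w.

(* Main.v *)
Require Import Defs.
From Stdlib Require Import ZArith FunctionalExtensionality Classical.
From mathcomp Require Import all_boot.
From mathcomp Require Import zify.
Set Implicit Arguments. Unset Strict Implicit. Unset Printing Implicit Defensive.

(* Hardness.  For a total oracle program [e], a register machine searches, for
   a = b + 1, ..., 0, a witness l with e(C, a, l, n) = 0, and then starts again
   with a larger b; it comes back to its initial instruction infinitely often
   iff every a has a witness.  The automaton runs this machine with a single
   head on unary registers, and any local inconsistency creates a spreading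
   dead state.  The word [display_word n] shows the head at the origin, at
   the initial instruction, with input n; the oracle and the counter b lie to
   its left, outside the word.  If the word recurs in some orbit, nothing ever
   dies, hence there is exactly one head and the orbit is a genuine computation
   for some oracle; stale contents of b do no harm, since each round checks all
   values from b + 1 down to 0.

   Upper bound and completeness.  A limit point of an orbit, together with the
   space-time diagram and the times of approach, can be guessed by an oracle and
   verified by local checks, uniformly in the local rule.  The resulting set
   [asymptotic_code] of pairs (local rule, word) is Sigma^1_1, and it is
   complete because every Sigma^1_1 set reduces to the language of some
   automaton.  The automaton built for [asymptotic_code] itself is therefore
   the one sought. *)

(** * Functions computable with an oracle *)

Definition ofun := (nat -> bool) -> seq nat -> nat.

Definition orec (n : nat) (F : ofun) : Prop :=
  exists e, forall C v, size v = n -> reval C e v (F C v).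

Lemma orec_ext n F G :
  (forall C v, size v = n -> F C v = G C v) -> orec n F -> orec n G.
Proof. by move=> FG [e He]; exists e => C v sv; rewrite -FG //; apply: He. Qed.

Fixpoint orecs (n : nat) (Fs : seq ofun) : Prop :=
  if Fs is F :: Fs' then orec n F /\ orecs n Fs' else True.

Lemma orec_comp n G Fs :
  orec (size Fs) G -> orecs n Fs ->
  orec n (fun C v => G C [seq F C v | F <- Fs]).
Proof.
move=> [g Hg] HFs.
have [hs Hhs] : exists hs, forall C v, size v = n ->
    revals C hs v [seq F C v | F <- Fs].
  elim: Fs HFs {Hg} => [_|F Fs IH /= [[h Hh] /IH[hs Hhs]]].
    by exists [::] => C v _; constructor.
  by exists (h :: hs) => C v sv; constructor; [apply: Hh | apply: Hhs].
exists (RComp g hs) => C v sv; apply: ev_comp (Hhs C v sv) _.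
by apply: Hg; rewrite size_map.
Qed.

Lemma orec_primrec n B S :
  orec n B -> orec n.+2 S ->
  orec n.+1 (fun C v => nat_rect (fun=> nat) (B C (behead v))
    (fun i a => S C [:: i, a & behead v]) (head 0 v)).
Proof.
move=> [b Hb] [s Hs]; exists (RPrimRec b s) => C [//|x v] /= [sv].
elim: x => [|x IH] /=; first by constructor; apply: Hb.
by apply: ev_recS IH _; apply: Hs; rewrite /= sv.
Qed.

Lemma orec_nth n i : orec n (fun _ v => nth 0 v i).
Proof. by exists (RProj i) => C v _; constructor. Qed.

Lemma orec0 n : orec n (fun _ _ => 0).
Proof. by exists RZero => C v _; constructor. Qed.

Lemma orecS n F : orec n F -> orec n (fun C v => (F C v).+1).
Proof.
move=> HF; apply: (@orec_comp n (fun _ v => (head 0 v).+1) [:: F]) => //.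
by exists RSucc => C v _; constructor.
Qed.

Lemma orec_const n c : orec n (fun _ _ => c).
Proof. by elim: c => [|c]; [apply: orec0 | apply: orecS]. Qed.

Lemma orec_oracle n F :
  orec n F -> orec n (fun C v => nat_of_bool (C (F C v))).
Proof.
move=> HF.
apply: (@orec_comp n (fun C v => nat_of_bool (C (head 0 v))) [:: F]) => //.
by exists ROracle => C v _; constructor.
Qed.

Lemma orec_rect n B N (S : (nat -> bool) -> seq nat -> nat -> nat -> nat) :
  orec n N -> orec n B ->
  orec n.+2 (fun C v => S C (drop 2 v) (nth 0 v 0) (nth 0 v 1)) ->
  orec n (fun C v => nat_rect (fun=> nat) (B C v) (S C v) (N C v)).
Proof.
move=> HN HB HS.
have /= := @orec_comp n _ (N :: [seq (fun _ v => nth 0 v i) | i <- iota 0 n]).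
rewrite size_map size_iota => /(_ _ (orec_primrec HB HS)) H.
apply: orec_ext (H _) => [C v sv|].
  have -> : [seq F C v | F <- [seq (fun _ v => nth 0 v i) | i <- iota 0 n] : seq ofun] = v.
    by rewrite -map_comp -[RHS](mkseq_nth 0) /mkseq sv; apply: eq_map.
  by rewrite /= drop0.
split=> //; elim: (iota 0 n) => //= i s IH; split=> //; exact: orec_nth.
Qed.

Lemma orec_drop n k F : orec n F -> orec (k + n) (fun C v => F C (drop k v)).
Proof.
move=> HF.
have := @orec_comp (k + n) F [seq (fun _ v => nth 0 v (k + i)) | i <- iota 0 n].
rewrite size_map size_iota => /(_ HF) H.
apply: orec_ext (H _) => [C v sv|].
  congr (F C _); rewrite -[RHS](mkseq_nth 0) /mkseq size_drop sv addKn -map_comp.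
  by apply: eq_map => i /=; rewrite nth_drop.
elim: (iota 0 n) {H} => //= i s IH; split=> //; exact: orec_nth.
Qed.

Lemma orec_shift2 n F : orec n F -> orec n.+2 (fun C v => F C (drop 2 v)).
Proof. exact: (@orec_drop n 2). Qed.

Lemma orec_add n F G : orec n F -> orec n G -> orec n (fun C v => F C v + G C v).
Proof.
move=> HF HG.
apply: orec_ext (orec_rect (S := fun _ _ _ a => a.+1) HF HG _) => [C v _|].
  by elim: (F C v) => //= x ->.
by apply/orecS/orec_nth.
Qed.

Lemma orec_mul n F G : orec n F -> orec n G -> orec n (fun C v => F C v * G C v).
Proof.
move=> HF HG.
apply: orec_ext (orec_rect (S := fun C v _ a => G C v + a) HF (orec0 n) _) => [C v _|].
  by elim: (F C v) => //= x ->.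
by apply: orec_add; [apply: orec_shift2 | apply: orec_nth].
Qed.

Lemma orec_pred n F : orec n F -> orec n (fun C v => (F C v).-1).
Proof.
move=> HF.
apply: orec_ext (orec_rect (S := fun C v i _ => i) HF (orec0 n) _) => [C v _|].
  by case: (F C v).
exact: orec_nth.
Qed.

Lemma orec_sub n F G : orec n F -> orec n G -> orec n (fun C v => F C v - G C v).
Proof.
move=> HF HG.
apply: orec_ext (orec_rect (S := fun _ _ _ a => a.-1) HG HF _) => [C v _|].
  by elim: (G C v) => /= [|x ->]; rewrite ?subn0 ?subnS.
by apply/orec_pred/orec_nth.
Qed.

Lemma orec_leq n F G :
  orec n F -> orec n G -> orec n (fun C v => nat_of_bool (F C v <= G C v)).
Proof.
move=> HF HG.
apply: orec_ext (orec_sub (orec_const n 1) (orec_sub HF HG)) => C v _.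
by case: leqP; lia.
Qed.

Lemma orec_and n (P Q : (nat -> bool) -> seq nat -> bool) :
  orec n (fun C v => nat_of_bool (P C v)) -> orec n (fun C v => nat_of_bool (Q C v)) ->
  orec n (fun C v => nat_of_bool (P C v && Q C v)).
Proof.
move=> HP HQ; apply: orec_ext (orec_mul HP HQ) => C v _.
by rewrite mulnb.
Qed.

Lemma orec_neg n (P : (nat -> bool) -> seq nat -> bool) :
  orec n (fun C v => nat_of_bool (P C v)) -> orec n (fun C v => nat_of_bool (~~ P C v)).
Proof.
move=> HP; apply: orec_ext (orec_sub (orec_const n 1) HP) => C v _.
by case: (P C v).
Qed.

Lemma orec_imp n (P Q : (nat -> bool) -> seq nat -> bool) :
  orec n (fun C v => nat_of_bool (P C v)) -> orec n (fun C v => nat_of_bool (Q C v)) ->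
  orec n (fun C v => nat_of_bool (P C v ==> Q C v)).
Proof.
move=> HP HQ; apply: orec_ext (orec_neg (orec_and HP (orec_neg HQ))) => C v _.
by case: (P C v) (Q C v) => [] [].
Qed.

Lemma orec_eq n F G :
  orec n F -> orec n G -> orec n (fun C v => nat_of_bool (F C v == G C v)).
Proof.
move=> HF HG; apply: orec_ext (orec_and (orec_leq HF HG) (orec_leq HG HF)) => C v _.
by rewrite -eqn_leq.
Qed.

Definition cnt (p : nat -> bool) (n : nat) : nat :=
  nat_rect (fun=> nat) 0 (fun i a => a + p i) n.

Lemma cnt_threshold p q n : (forall i, p i = (i < q)) -> cnt p n = minn q n.
Proof.
move=> pE; elim: n => [|n /= ->]; first by rewrite minn0.
by rewrite pE; case: ltnP => /=; lia.
Qed.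

Lemma orec_cnt n N (p : (nat -> bool) -> seq nat -> nat -> bool) :
  orec n N ->
  orec n.+2 (fun C v => nat_of_bool (p C (drop 2 v) (nth 0 v 0))) ->
  orec n (fun C v => cnt (p C v) (N C v)).
Proof.
move=> HN Hp.
apply: (orec_rect (S := fun C v i a => a + p C v i) HN (orec0 n)).
by apply: orec_add => //; apply: orec_nth.
Qed.

Definition cdiv (m k : nat) : nat := cnt (fun i => i.+1 * k <= m) m.

Lemma cdivE m k : 0 < k -> cdiv m k = m %/ k.
Proof.
move=> k_gt0; rewrite /cdiv (@cnt_threshold _ (m %/ k)) => [|i].
  by apply/minn_idPl/leq_div.
by rewrite leq_divRL.
Qed.

Lemma orec_div n F G : orec n F -> orec n G -> orec n (fun C v => cdiv (F C v) (G C v)).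
Proof.
move=> HF HG; apply: (orec_cnt (p := fun C v i => i.+1 * G C v <= F C v)) => //.
apply: orec_leq; last exact: orec_shift2.
by apply: orec_mul; [apply/orecS/orec_nth | apply: orec_shift2].
Qed.

Definition sqr_pair (a b : nat) : nat := (a + b) ^ 2 + a.
Definition csqrt (m : nat) : nat := cnt (fun i => i.+1 * i.+1 <= m) m.
Definition fst_sqr (m : nat) : nat := m - csqrt m * csqrt m.
Definition snd_sqr (m : nat) : nat := csqrt m - fst_sqr m.

Lemma csqrt_pair a b : csqrt (sqr_pair a b) = a + b.
Proof.
rewrite /csqrt (@cnt_threshold _ (a + b)) /sqr_pair => [|i]; first by apply/minn_idPl; nia.
by rewrite -mulnn; case: (ltnP i (a + b)) => Hi; [apply/idP | apply/negbTE]; nia.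
Qed.

Lemma fst_sqrK a b : fst_sqr (sqr_pair a b) = a.
Proof. by rewrite /fst_sqr csqrt_pair /sqr_pair -mulnn addKn. Qed.

Lemma snd_sqrK a b : snd_sqr (sqr_pair a b) = b.
Proof. by rewrite /snd_sqr csqrt_pair fst_sqrK addKn. Qed.

Lemma orec_pair n F G : orec n F -> orec n G -> orec n (fun C v => sqr_pair (F C v) (G C v)).
Proof.
move=> HF HG; apply: orec_add => //.
apply: (@orec_ext _ (fun C v => (F C v + G C v) * (F C v + G C v))) => [C v _|].
  by rewrite -mulnn.
by apply: orec_mul; apply: orec_add.
Qed.

Lemma orec_csqrt n F : orec n F -> orec n (fun C v => csqrt (F C v)).
Proof.
move=> HF; apply: (orec_cnt (p := fun C v i => i.+1 * i.+1 <= F C v)) => //.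
by apply: orec_leq (orec_shift2 HF); apply: orec_mul; apply/orecS/orec_nth.
Qed.

Lemma orec_fst n F : orec n F -> orec n (fun C v => fst_sqr (F C v)).
Proof. by move=> HF; apply: orec_sub => //; apply: orec_mul; apply: orec_csqrt. Qed.

Lemma orec_snd n F : orec n F -> orec n (fun C v => snd_sqr (F C v)).
Proof. by move=> HF; apply: orec_sub; [apply: orec_csqrt | apply: orec_fst]. Qed.

(* On word codes [code_drop k j] removes the first [j] letters, and
   [code_nth k w j] is the rank of letter [j]. *)
Definition code_drop (k w j : nat) : nat :=
  nat_rect (fun=> nat) w (fun _ a => cdiv a.-1 k) j.
Definition code_nth (k w j : nat) : nat :=
  (code_drop k w j).-1 - cdiv (code_drop k w j).-1 k * k.

Lemma orec_code_drop n F G H : orec n F -> orec n G -> orec n H ->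
  orec n (fun C v => code_drop (F C v) (G C v) (H C v)).
Proof.
move=> HF HG HH; apply: (orec_rect (S := fun C v _ a => cdiv a.-1 (F C v))) => //.
by apply: orec_div; [apply/orec_pred/orec_nth | apply: orec_shift2].
Qed.

Lemma orec_code_nth n F G H : orec n F -> orec n G -> orec n H ->
  orec n (fun C v => code_nth (F C v) (G C v) (H C v)).
Proof.
move=> HF HG HH; have Hd := orec_code_drop HF HG HH.
apply: orec_sub; first exact: orec_pred.
by apply: orec_mul => //; apply: orec_div => //; apply: orec_pred.
Qed.

Section WordCode.
Variable S : finType.
Implicit Types (w : seq S) (a : S).

Lemma rank_divE a n : cdiv (enum_rank a + #|S| * n) #|S| = n.
Proof.
have rk : enum_rank a < #|S| := ltn_ord _.
rewrite cdivE; last exact: leq_ltn_trans rk.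
by rewrite addnC mulnC divnMDl ?divn_small ?addn0 //; apply: leq_ltn_trans rk.
Qed.

Lemma code_dropE w j : code_drop #|S| (word_code w) j = word_code (drop j w).
Proof.
elim: j => [|j IH] /=; first by rewrite drop0.
rewrite IH -add1n -drop_drop; case: (drop j w) => [|a w'] //=.
by rewrite drop0 rank_divE.
Qed.

Lemma code_nthE a w j :
  j < size w -> code_nth #|S| (word_code w) j = enum_rank (nth a w j).
Proof.
move=> Hj; rewrite /code_nth code_dropE (drop_nth a Hj) /=.
by rewrite rank_divE [_ * #|S|]mulnC addnK.
Qed.

Lemma word_code_eq0 w : (word_code w == 0) = (w == [::]).
Proof. by case: w. Qed.

Lemma word_code_inj : injective (@word_code S).
Proof.
move=> w w' E.
have Esz (u u' : seq S) : word_code u = word_code u' -> size u <= size u'.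
  move=> Eu; move/eqP: (code_dropE u (size u')).
  by rewrite Eu code_dropE drop_size eq_sym word_code_eq0 -size_eq0 size_drop subn_eq0.
have sww' : size w = size w' by apply/eqP; rewrite eqn_leq !Esz.
case: w E sww' => [|a w] E sww'; first by case: w' sww' {E}.
apply: (@eq_from_nth _ a) => // j Hj; apply/enum_rank_inj/val_inj.
by rewrite /= -!code_nthE ?E // -sww'.
Qed.

Lemma word_code_surj n : 0 < #|S| -> exists w, word_code w = n.
Proof.
move=> S_gt0; have [m] := ubnP n; elim: m n => // m IH [|n] Hn; first by exists [::].
have [|w Hw] := IH (n %/ #|S|).
  by apply: leq_ltn_trans (leq_div _ _) _.
exists (enum_val (Ordinal (ltn_pmod n S_gt0)) :: w).
by rewrite /= Hw enum_valK /= mulnC addSn addnC -divn_eq.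
Qed.
End WordCode.

Lemma computable_orec (f : nat -> nat) : orec 1 (fun _ v => f (nth 0 v 0)) -> computable f.
Proof. by move=> [e He]; exists e => n; apply: (He (fun=> false) [:: n]). Qed.

Section RevalInd.
Variables (C : nat -> bool) (P : rfun -> seq nat -> nat -> Prop).
Variable Ps : list rfun -> seq nat -> seq nat -> Prop.
Hypotheses (P_zero : forall v, P RZero v 0)
  (P_succ : forall v, P RSucc v (head 0 v).+1)
  (P_proj : forall i v, P (RProj i) v (nth 0 v i))
  (P_oracle : forall v, P ROracle v (if C (head 0 v) then 1 else 0))
  (P_comp : forall g hs v ws r, Ps hs v ws -> P g ws r -> P (RComp g hs) v r)
  (P_rec0 : forall b s v r, P b v r -> P (RPrimRec b s) (0 :: v) r)
  (P_recS : forall b s n v a r, P (RPrimRec b s) (n :: v) a ->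
     P s [:: n, a & v] r -> P (RPrimRec b s) (n.+1 :: v) r)
  (P_recnil : forall b s r, P (RPrimRec b s) [:: 0] r -> P (RPrimRec b s) [::] r)
  (P_mu : forall g v n, P g (n :: v) 0 ->
     (forall m, m < n -> exists2 r, P g (m :: v) r & r <> 0) -> P (RMu g) v n)
  (Ps_nil : forall v, Ps nil v [::])
  (Ps_cons : forall h hs v w ws, P h v w -> Ps hs v ws -> Ps (h :: hs) v (w :: ws)).

(* The principle generated by [Scheme] has no induction hypothesis under the
   [exists2] of [ev_mu]. *)
Fixpoint reval_mut e v r (E : reval C e v r) {struct E} : P e v r :=
  match E in reval _ e v r return P e v r with
  | ev_zero v => P_zero v
  | ev_succ v => P_succ v
  | ev_proj i v => P_proj i v
  | ev_oracle v => P_oracle v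
  | ev_comp g hs v ws r Es Eg => P_comp (revals_mut Es) (reval_mut Eg)
  | ev_rec0 b s v r Eb => P_rec0 s (reval_mut Eb)
  | ev_recS b s n v a r Er Es => P_recS (reval_mut Er) (reval_mut Es)
  | ev_recnil b s r Er => P_recnil (reval_mut Er)
  | ev_mu g v n En Em => P_mu (reval_mut En) (fun m lt_mn =>
      match Em m lt_mn with
      | ex_intro2 r Er r_neq0 => ex_intro2 _ _ r (reval_mut Er) r_neq0
      end)
  end
with revals_mut hs v ws (E : revals C hs v ws) {struct E} : Ps hs v ws :=
  match E in revals _ hs v ws return Ps hs v ws with
  | evs_nil v => Ps_nil v
  | evs_cons h hs v w ws Eh Es => Ps_cons (reval_mut Eh) (revals_mut Es)
  end.
End RevalInd.

(* Replacing oracle calls by zero makes a program insensitive to the oracle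
   while keeping its behaviour under the empty oracle. *)
Fixpoint no_oracle (e : rfun) : rfun :=
  match e with
  | ROracle => RZero
  | RComp g hs => RComp (no_oracle g) (map no_oracle hs)
  | RPrimRec b s => RPrimRec (no_oracle b) (no_oracle s)
  | RMu g => RMu (no_oracle g)
  | _ => e
  end.

Lemma no_oracle_eval C e v r : reval (fun=> false) e v r -> reval C (no_oracle e) v r.
Proof.
move: e v r; apply: (@reval_mut (fun=> false)
  (fun e v r => reval C (no_oracle e) v r)
  (fun hs v ws => revals C (map no_oracle hs) v ws)) => /=.
- by move=> v; constructor.
- by move=> v; constructor.
- by move=> i v; constructor.
- by move=> v; constructor.
- by move=> g hs v ws r IHs IH; apply: ev_comp IHs IH.
- by move=> b s v r IH; constructor.
- by move=> b s n v a r IH1 IH2; apply: ev_recS IH1 IH2.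
- by move=> b s r IH; constructor.
- by move=> g v n IH IHm; constructor.
- by move=> v; constructor.
- by move=> h hs v w ws IH IHs; constructor.
Qed.

Lemma orec_computable n (f : nat -> nat) F :
  computable f -> orec n F -> orec n (fun C v => f (F C v)).
Proof.
move=> [e He] HF; apply: (@orec_comp n (fun _ v => f (head 0 v)) [:: F]) => //.
exists (no_oracle e) => C [|x []] // _; exact: no_oracle_eval.
Qed.

Lemma many_one_trans P Q T :
  many_one_reducible P Q -> many_one_reducible Q T -> many_one_reducible P T.
Proof.
move=> [f [Hf PQ]] [g [Hg QT]]; exists (fun n => g (f n)); split; last first.
  by move=> w; rewrite PQ QT.
apply: computable_orec.
by apply: (orec_computable Hg); apply: (orec_computable Hf); apply: orec_nth.
Qed.

Lemma reval_fun C e v r : reval C e v r -> forall r', reval C e v r' -> r = r'.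
Proof.
move: e v r; apply: (@reval_mut C
  (fun e v r => forall r', reval C e v r' -> r = r')
  (fun hs v ws => forall ws', revals C hs v ws' -> ws = ws')).
- by move=> v r' E; inversion E.
- by move=> v r' E; inversion E.
- by move=> i v r' E; inversion E.
- by move=> v r' E; inversion E.
- move=> g hs v ws r IHs IH r' E.
  by inversion E as [| | | |? ? ? ws' ? Es Eg| | | |]; subst; apply: IH; rewrite (IHs _ Es).
- by move=> b s v r IH r' E; inversion E; subst; apply: IH.
- move=> b s n v a r IH1 IH2 r' E.
  inversion E as [| | | | | |? ? ? ? a' ? Er Es| |]; subst.
  by apply: IH2; rewrite (IH1 _ Er).
- by move=> b s r IH r' E; inversion E; subst; apply: IH.
- move=> g v n IH IHm r' E.
  inversion E as [| | | | | | | |? ? ? En Em]; subst.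
  case: (ltngtP n r') => // Hlt.
    by have [r Hr] := Em _ Hlt; case; rewrite -(IH _ Hr).
  by have [r Hr] := IHm _ Hlt; case; rewrite (Hr _ En).
- by move=> v ws' E; inversion E.
- move=> h hs v w ws IH IHs ws' E.
  by inversion E as [|? ? ? ? ? Eh Es]; subst; rewrite (IH _ Eh) (IHs _ Es).
Qed.

Lemma Sigma11_orec (R : (nat -> bool) -> nat -> nat -> nat -> bool) (P : nat -> Prop) :
  orec 3 (fun C v => nat_of_bool (R C (nth 0 v 0) (nth 0 v 1) (nth 0 v 2))) ->
  (forall w, P w <-> exists C, forall m, exists l, R C m l w) -> Sigma11 P.
Proof.
move=> /orec_neg[e He] PR; have {}He C m l w := He C [:: m; l; w] erefl.
exists e; split=> [C m l w|w]; first by eexists; apply: He.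
rewrite PR; split=> -[C HC]; exists C => m; have [l Hl] := HC m; exists l.
  by have := He C m l w; rewrite /= Hl.
by have /= := reval_fun (He C m l w) Hl; case: (R _ _ _ _).
Qed.

Lemma Sigma11_reducible P Q : many_one_reducible P Q -> Sigma11 Q -> Sigma11 P.
Proof.
move=> [f [Hf PQ]] [e [etot HQ]].
have [h Hh] : orec 3 (fun _ v => f (nth 0 v 2)) by apply: (orec_computable Hf); apply: orec_nth.
pose e' := RComp e [:: RProj 0; RProj 1; h].
have e'E C m l w r : reval C e [:: m; l; f w] r -> reval C e' [:: m; l; w] r.
  apply: ev_comp; do 2! [constructor; first by constructor].
  by constructor; [apply: Hh | constructor].
exists e'; split=> [C m l w|w].
  by have [r Hr] := etot C m l (f w); exists r; apply: e'E.
rewrite PQ HQ; split=> -[C HC]; exists C => m; have [l Hl] := HC m; exists l.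
  exact: e'E.
have [r Hr] := etot C m l (f w).
by rewrite (reval_fun Hl (e'E _ _ _ _ _ Hr)).
Qed.

(* The oracle [C] describes configurations by their cells: [dcell C t p q s]
   says that cell [p - q] of row [t] carries the letter of rank [s].  Row [0] is
   the limit configuration, row [t.+1] the [t]-th iterate.  [dmark C t r]
   promises that row [t.+1] agrees with row [0] at radius [r]. *)
Definition dcell (C : nat -> bool) t p q s :=
  C (sqr_pair 0 (sqr_pair t (sqr_pair p (sqr_pair q s)))).
Definition dmark (C : nat -> bool) t r := C (sqr_pair 1 (sqr_pair t r)).

Definition diagram_check C k T w t p q a b c l1 l2 : bool :=
  [&& (l1 < k) && dcell C t p q l1,
      dcell C t p q a ==> (dcell C t p q b ==> (a == b)),
      dcell C t p q a ==> dcell C t p.+1 q.+1 a,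
      dcell C t.+1 p q.+1 a ==> (dcell C t.+1 p q b ==> (dcell C t.+1 p.+1 q c ==>
        dcell C t.+2 p q (code_nth k T (a * k * k + b * k + c)))) &
  [&& (t <= l2) && dmark C l2 t,
      dmark C t a ==> ((p <= q + a) ==> ((q <= p + a) ==>
        (dcell C t.+1 p q b ==> dcell C 0 p q b))) &
      dcell C 0 p 0 a ==> ((1 <= code_drop k w p) ==> (a == code_nth k w p))]].

Definition asymptotic_check (C : nat -> bool) m l z : bool :=
  diagram_check C (fst_sqr z) (fst_sqr (snd_sqr z)) (snd_sqr (snd_sqr z))
    (fst_sqr m) (fst_sqr (snd_sqr m)) (fst_sqr (snd_sqr (snd_sqr m)))
    (fst_sqr (snd_sqr (snd_sqr (snd_sqr m))))
    (fst_sqr (snd_sqr (snd_sqr (snd_sqr (snd_sqr m)))))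
    (snd_sqr (snd_sqr (snd_sqr (snd_sqr (snd_sqr m)))))
    (fst_sqr l) (snd_sqr l).

Ltac orec_tac :=
  lazymatch goal with
  | |- orec _ (fun C v => nat_of_bool (@?P C v && @?Q C v)) => apply: (@orec_and _ P Q)
  | |- orec _ (fun C v => nat_of_bool (@?P C v ==> @?Q C v)) => apply: (@orec_imp _ P Q)
  | |- orec _ (fun C v => nat_of_bool (@?F C v <= @?G C v)) => apply: (@orec_leq _ F G)
  | |- orec _ (fun C v => nat_of_bool (@?F C v == @?G C v)) => apply: (@orec_eq _ F G)
  | |- orec _ (fun C v => nat_of_bool (C (@?F C v))) => apply: (@orec_oracle _ F)
  | |- orec _ (fun C v => fst_sqr (@?F C v)) => apply: (@orec_fst _ F)
  | |- orec _ (fun C v => snd_sqr (@?F C v)) => apply: (@orec_snd _ F)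
  | |- orec _ (fun C v => sqr_pair (@?F C v) (@?G C v)) => apply: (@orec_pair _ F G)
  | |- orec _ (fun C v => code_nth (@?F C v) (@?G C v) (@?H C v)) =>
      apply: (@orec_code_nth _ F G H)
  | |- orec _ (fun C v => code_drop (@?F C v) (@?G C v) (@?H C v)) =>
      apply: (@orec_code_drop _ F G H)
  | |- orec _ (fun C v => @?F C v + @?G C v) => apply: (@orec_add _ F G)
  | |- orec _ (fun C v => @?F C v * @?G C v) => apply: (@orec_mul _ F G)
  | |- orec _ (fun C v => (@?F C v).+1) => apply: (@orecS _ F)
  | |- orec _ (fun _ _ => 0) => exact: orec0
  | |- orec _ (fun _ v => nth 0 v _) => exact: orec_nth
  end.

Lemma orec_asymptotic_check :
  orec 3 (fun C v => nat_of_bool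
    (asymptotic_check C (nth 0 v 0) (nth 0 v 1) (nth 0 v 2))).
Proof.
rewrite /asymptotic_check /diagram_check /dcell /dmark.
by repeat orec_tac.
Qed.

(** * Asymptotic languages are uniformly Sigma^1_1 *)

Definition asymptotic_code (z : nat) : Prop :=
  exists C, forall m, exists l, asymptotic_check C m l z.

Lemma Sigma11_asymptotic_code : Sigma11 asymptotic_code.
Proof. exact: (Sigma11_orec orec_asymptotic_check). Qed.

Definition local_map (S : Type) (d : S -> S -> S -> S) (x : config S) : config S :=
  fun i => d (x (i - 1)%Z) (x i) (x (i + 1)%Z).

Lemma local_map_ca (S : Type) (d : S -> S -> S -> S) : cellular_automaton (local_map d).
Proof.
split=> [x n|x i].
  by exists n.+1 => y xy i Hi; rewrite /local_map !xy //; lia.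
by rewrite /local_map /shift; congr (d (x _) (x _) (x _)); lia.
Qed.

Section RuleCode.
Variables (S : finType) (s0 : S) (d : S -> S -> S -> S).
Let k := #|S|.

Definition letter (i : nat) : S := nth s0 (enum S) i.

Lemma letterK a : letter (enum_rank a) = a.
Proof. exact: nth_enum_rank. Qed.

Lemma rank_lt (a : S) : enum_rank a < k.
Proof. exact: ltn_ord. Qed.

Lemma letter_rank i : i < k -> enum_rank (letter i) = i :> nat.
Proof.
move=> Hi; have -> : letter i = enum_val (Ordinal Hi) by rewrite (enum_val_nth s0).
by rewrite enum_valK.
Qed.

Definition rule_code : nat :=
  word_code (mkseq (fun j => d (letter (j %/ k %/ k)) (letter (j %/ k %% k)) (letter (j %% k)))
    (k * k * k)).

Lemma rule_codeE a b c :
  code_nth k rule_code (enum_rank a * k * k + enum_rank b * k + enum_rank c) =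
  enum_rank (d a b c).
Proof.
have [Ha Hb Hc] := And3 (rank_lt a) (rank_lt b) (rank_lt c).
rewrite -mulnDl (code_nthE s0); last by rewrite size_mkseq; nia.
rewrite nth_mkseq; last nia.
have k_gt0 : 0 < k by lia.
have divE m n : n < k -> (m * k + n) %/ k = m.
  by move=> Hn; rewrite divnMDl // divn_small ?addn0.
have modE m n : n < k -> (m * k + n) %% k = n.
  by move=> Hn; rewrite modnMDl modn_small.
by rewrite !divE // !modE // !letterK.
Qed.

End RuleCode.

Section AsymptoticCode.
Variables (S : finType) (s0 : S) (d : S -> S -> S -> S).
Let k := #|S|.
Let f := local_map d.
Definition rule_word (v : nat) : nat := sqr_pair k (sqr_pair (rule_code s0 d) v).

Lemma asymptotic_codeE v :
  asymptotic_code (rule_word v) <->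
  exists C, forall t p q a b c, exists l1 l2,
    diagram_check C k (rule_code s0 d) v t p q a b c l1 l2.
Proof.
rewrite /asymptotic_code /asymptotic_check /rule_word !(fst_sqrK, snd_sqrK).
split=> -[C HC]; exists C.
  move=> t p q a b c.
  pose m := sqr_pair t (sqr_pair p (sqr_pair q (sqr_pair a (sqr_pair b c)))).
  have [l] := HC m; rewrite /m !(fst_sqrK, snd_sqrK) => Hl.
  by exists (fst_sqr l), (snd_sqr l).
move=> m.
have [l1 [l2 Hl]] := HC (fst_sqr m) (fst_sqr (snd_sqr m)) (fst_sqr (snd_sqr (snd_sqr m)))
    (fst_sqr (snd_sqr (snd_sqr (snd_sqr m))))
    (fst_sqr (snd_sqr (snd_sqr (snd_sqr (snd_sqr m)))))
    (snd_sqr (snd_sqr (snd_sqr (snd_sqr (snd_sqr m))))).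
by exists (sqr_pair l1 l2); rewrite !(fst_sqrK, snd_sqrK).
Qed.

Definition agree_onb (m : nat) (x y : config S) : bool :=
  all (fun i => (x (Z.of_nat i) == y (Z.of_nat i)) &&
                (x (- Z.of_nat i)%Z == y (- Z.of_nat i)%Z)) (iota 0 m.+1).

Lemma agree_onP m x y : reflect (agree_on m x y) (agree_onb m x y).
Proof.
apply: (iffP allP) => [xy i Hi|xy i].
  have /xy/andP[/eqP xyi /eqP xyNi] : Z.to_nat (Z.abs i) \in iota 0 m.+1.
    by rewrite mem_iota; lia.
  have [Hi0|Hi0] : (i = Z.of_nat (Z.to_nat (Z.abs i)) \/
    i = - Z.of_nat (Z.to_nat (Z.abs i)))%Z by lia.
  - by rewrite Hi0.
  - by rewrite Hi0.
by rewrite mem_iota => Hi; rewrite !xy ?eqxx //; lia.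
Qed.

Let rows (x y : config S) (t : nat) : config S := if t is t'.+1 then iter t' f x else y.

Let oracle (x y : config S) (n : nat) : bool :=
  let r := snd_sqr n in let u := snd_sqr r in
  if fst_sqr n == 0 then
    enum_rank (rows x y (fst_sqr r) (Z.of_nat (fst_sqr u) - Z.of_nat (fst_sqr (snd_sqr u)))%Z)
      == snd_sqr (snd_sqr u) :> nat
  else agree_onb u (rows x y (fst_sqr r).+1) y.

Lemma oracle_cell x y t p q s :
  dcell (oracle x y) t p q s =
  (enum_rank (rows x y t (Z.of_nat p - Z.of_nat q)%Z) == s :> nat).
Proof. by rewrite /dcell /oracle !(fst_sqrK, snd_sqrK). Qed.

Lemma oracle_mark x y t r :
  dmark (oracle x y) t r = agree_onb r (iter t f x) y.
Proof. by rewrite /dmark /oracle !(fst_sqrK, snd_sqrK). Qed.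

Lemma languageN_asymptotic_code v :
  languageN (asymptotic_set f) v <-> asymptotic_code (rule_word v).
Proof.
rewrite asymptotic_codeE; split.
  move=> [w [wv [y [[x xy] wy]]]]; exists (oracle x y) => t p q a b c.
  have [l2 [Hl2 /agree_onP agr]] := xy t t.
  exists (enum_rank (rows x y t (Z.of_nat p - Z.of_nat q)%Z)), l2.
  rewrite /diagram_check !oracle_cell !oracle_mark; apply/and5P; split; last (apply/and3P; split).
  - by rewrite rank_lt eqxx.
  - by apply/implyP=> /eqP <-; apply/implyP.
  - by apply/implyP => /eqP <-; apply/eqP; congr (nat_of_ord (enum_rank (rows _ _ _ _))); lia.
  - apply/implyP => /eqP <-; apply/implyP => /eqP <-; apply/implyP => /eqP <-.
    rewrite rule_codeE /= /f /local_map.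
    have -> : (Z.of_nat p - Z.of_nat q - 1 = Z.of_nat p - Z.of_nat q.+1)%Z by lia.
    by have -> : (Z.of_nat p - Z.of_nat q + 1 = Z.of_nat p.+1 - Z.of_nat q)%Z by lia.
  - by apply/andP.
  - apply/implyP => /agree_onP ta; apply/implyP => pqa; apply/implyP => qpa.
    by rewrite /= ta; [apply/implyP | lia].
  - apply/implyP => /eqP <-; apply/implyP; rewrite -wv code_dropE.
    case: (ltnP p (size w)) => Hp; last by rewrite drop_oversize.
    rewrite (code_nthE s0) // => _; rewrite wy (nth_map 0) ?size_iota // nth_iota //= add0n.
    by apply/eqP; congr (nat_of_ord (enum_rank (y _))); lia.
move=> [C HC].
have [w wv] : exists w : seq S, word_code w = v.
  by apply: word_code_surj; apply: leq_ltn_trans (rank_lt s0).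
have tot t p q : exists s : S, dcell C t p q (enum_rank s).
  have [l1 [l2 /and5P[/andP[l1k Hl1] _ _ _ _]]] := HC t p q 0 0 0.
  by exists (letter s0 l1); rewrite letter_rank.
have uniq t p q (s s' : S) :
    dcell C t p q (enum_rank s) -> dcell C t p q (enum_rank s') -> s = s'.
  have [l1 [l2 /and5P[_ H _ _ _]]] := HC t p q (enum_rank s) (enum_rank s') 0.
  by move=> /(implyP H)/implyP H' /H'/eqP/val_inj/enum_rank_inj.
have diag t p q a : dcell C t p q a -> forall j, dcell C t (j + p) (j + q) a.
  move=> Ha; elim=> // j IH.
  have [l1 [l2 /and5P[_ _ /implyP/(_ IH) //]]] := HC t (j + p) (j + q) a 0 0.
pose X t (i : Z) : S := odflt s0 [pick s | dcell C t (Z.to_nat i) (Z.to_nat (- i)) (enum_rank s)].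
have XP t p q : dcell C t p q (enum_rank (X t (Z.of_nat p - Z.of_nat q)%Z)).
  rewrite /X; set p' := Z.to_nat _; set q' := Z.to_nat _.
  case: pickP => [s Hs|none] /=; last by have [s] := tot t p' q'; rewrite none.
  have := diag _ _ _ _ Hs (minn p q).
  have -> : minn p q + p' = p by lia.
  by have -> : minn p q + q' = q by lia.
have Xuniq t p q s : dcell C t p q (enum_rank s) -> X t (Z.of_nat p - Z.of_nat q)%Z = s.
  by apply: uniq.
have Zsub (i : Z) : exists p q, i = (Z.of_nat p - Z.of_nat q)%Z.
  by exists (Z.to_nat i), (Z.to_nat (- i)); lia.
have Xiter t : X t.+1 = iter t f (X 1).
  elim: t => //= t <-; apply: functional_extensionality => i.
  have [p [q ->]] := Zsub i; apply: Xuniq.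
  have Ha := XP t.+1 p q.+1; have Hb := XP t.+1 p q; have Hc := XP t.+1 p.+1 q.
  have [l1 [l2 /and5P[_ _ _ /implyP/(_ Ha)/implyP/(_ Hb)/implyP/(_ Hc) H _]]] :=
    HC t p q (enum_rank (X t.+1 (Z.of_nat p - Z.of_nat q.+1)%Z))
      (enum_rank (X t.+1 (Z.of_nat p - Z.of_nat q)%Z))
      (enum_rank (X t.+1 (Z.of_nat p.+1 - Z.of_nat q)%Z)).
  move: H; rewrite rule_codeE /f /local_map.
  have -> : (Z.of_nat p - Z.of_nat q - 1 = Z.of_nat p - Z.of_nat q.+1)%Z by lia.
  by have -> : (Z.of_nat p - Z.of_nat q + 1 = Z.of_nat p.+1 - Z.of_nat q)%Z by lia.
exists w; split=> //; exists (X 0); split.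
  exists (X 1) => n m.
  have [l1 [l2 /and5P[_ _ _ _ /and3P[/andP[Hl2 mk] _ _]]]] := HC (maxn n m) 0 0 0 0 0.
  exists l2; split; first lia.
  move=> i Hi; rewrite -Xiter; have [p [q Epq]] := Zsub i.
  rewrite Epq; apply/esym/Xuniq; have Hb := XP l2.+1 p q.
  have [? [? /and5P[_ _ _ _ /and3P[_ /implyP/(_ mk) H _]]]] :=
    HC l2 p q (maxn n m) (enum_rank (X l2.+1 (Z.of_nat p - Z.of_nat q)%Z)) 0.
  have pqn : p <= q + maxn n m by lia.
  have qpn : q <= p + maxn n m by lia.
  by move: H => /implyP/(_ pqn)/implyP/(_ qpn)/implyP/(_ Hb).
apply: (@eq_from_nth _ s0); first by rewrite size_map size_iota.
move=> p Hp; rewrite (nth_map 0) ?size_iota // nth_iota // add0n.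
have Ha := XP 0 p 0.
have [? [? /and5P[_ _ _ _ /and3P[_ _ /implyP/(_ Ha)]]]] :=
  HC 0 p 0 (enum_rank (X 0 (Z.of_nat p - Z.of_nat 0)%Z)) 0 0.
rewrite -wv code_dropE (code_nthE s0) // (drop_nth s0) //= => /eqP/val_inj/enum_rank_inj <-.
by congr (X 0 _); lia.
Qed.
End AsymptoticCode.

(** * Structured register programs *)

Definition regs := nat -> nat.
Definition upd (rho : regs) (i v : nat) : regs := fun j => if j == i then v else rho j.

(* Register 0 holds the input; it will lie on the half-line that carries no
   oracle, so [Ask 0 j] finds nothing. *)
Inductive cmd : Type :=
| Skip
| Seq (c d : cmd)
| Inc (i : nat)
| Ask (i j : nat)
| Loop (i : nat) (c : cmd)
| IfDec (i : nat) (c d : cmd).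

Inductive exec (o : nat -> bool) : cmd -> regs -> regs -> Prop :=
| exec_skip rho : exec o Skip rho rho
| exec_seq c d rho rho' rho'' :
    exec o c rho rho' -> exec o d rho' rho'' -> exec o (Seq c d) rho rho''
| exec_inc i rho : exec o (Inc i) rho (upd rho i (rho i).+1)
| exec_ask i j rho : exec o (Ask i j) rho (upd rho j (rho j + ((i != 0) && o (rho i))))
| exec_loop0 i c rho : rho i = 0 -> exec o (Loop i c) rho rho
| exec_loopS i c rho rho' rho'' n : rho i = n.+1 ->
    exec o c (upd rho i n) rho' -> exec o (Loop i c) rho' rho'' ->
    exec o (Loop i c) rho rho''
| exec_if0 i c d rho rho' : rho i = 0 -> exec o d rho rho' -> exec o (IfDec i c d) rho rho'
| exec_ifS i c d rho rho' n : rho i = n.+1 -> exec o c (upd rho i n) rho' ->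
    exec o (IfDec i c d) rho rho'.

Ltac regs_ext := apply: functional_extensionality => ?; rewrite /upd;
  repeat (case: eqP => ? //=); subst; try congruence; try lia.

Section Exec.
Variable o : nat -> bool.
Implicit Types (rho : regs).

Lemma exec_eq c rho rho' rho'' : exec o c rho rho' -> rho' = rho'' -> exec o c rho rho''.
Proof. by move=> H <-. Qed.

Definition clear a := Loop a Skip.
Definition move a b := Loop a (Inc b).
Definition copy a t b := Seq (Loop a (Seq (Inc t) (Inc b))) (move t a).

Lemma exec_clear a rho : exec o (clear a) rho (upd rho a 0).
Proof.
have [n] := ubnP (rho a); elim: n rho => // n IH rho Hn.
case E: (rho a) => [|m].
  by apply: exec_eq; [apply: exec_loop0 | regs_ext].
apply: exec_eq; first apply: (exec_loopS E (exec_skip _ _) (IH _ _)).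
  by rewrite /upd eqxx; lia.
by regs_ext.
Qed.

Lemma exec_move a b rho : a <> b ->
  exec o (move a b) rho (upd (upd rho b (rho b + rho a)) a 0).
Proof.
move=> ab; have [n] := ubnP (rho a); elim: n rho => // n IH rho Hn.
case E: (rho a) => [|m].
  by apply: exec_eq; [apply: exec_loop0 | regs_ext].
apply: exec_eq; first apply: (exec_loopS E (exec_inc _ _ _) (IH _ _)).
  by rewrite /upd eqxx; case: eqP => //; lia.
by regs_ext.
Qed.

Lemma exec_copy a t b rho : a <> t -> a <> b -> t <> b -> rho t = 0 ->
  exec o (copy a t b) rho (upd rho b (rho b + rho a)).
Proof.
move=> a_t ab tb t0.
have H : exec o (Loop a (Seq (Inc t) (Inc b))) rho
    (upd (upd (upd rho b (rho b + rho a)) t (rho t + rho a)) a 0).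
  have [n] := ubnP (rho a); elim: n rho {t0} => // n IH rho Hn.
  case E: (rho a) => [|m].
    by apply: exec_eq; [apply: exec_loop0 | regs_ext].
  apply: exec_eq.
    apply: (exec_loopS E (exec_seq (exec_inc _ _ _) (exec_inc _ _ _)) (IH _ _)).
    by rewrite /upd eqxx; repeat case: eqP => //; lia.
  by regs_ext.
apply: exec_eq; first by apply: (exec_seq H (exec_move _ _)); congruence.
by regs_ext.
Qed.

Lemma rfun_nested_ind (P : rfun -> Prop) :
  P RZero -> P RSucc -> (forall i, P (RProj i)) -> P ROracle ->
  (forall g hs, P g -> foldr (fun h Q => P h /\ Q) True hs -> P (RComp g hs)) ->
  (forall b s, P b -> P s -> P (RPrimRec b s)) -> (forall g, P g -> P (RMu g)) ->
  forall e, P e.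
Proof.
move=> P0 PS Pp Po Pc Pr Pm; fix IH 1; case; [exact: P0 | exact: PS | exact: Pp | exact: Po | | |].
- move=> g hs; apply: Pc; first exact: IH.
  by move: hs; fix IHs 1; case=> [|h hs]; [exact: I | split; [exact: IH | exact: IHs]].
- by move=> b s; apply: Pr; apply: IH.
- by move=> g; apply: Pm; apply: IH.
Qed.

Fixpoint clears (p m : nat) : cmd := if m is m'.+1 then Seq (clear p) (clears p.+1 m') else Skip.

(* [compile e args out free] adds to register [out] the value of [e] on the
   contents of [args]; the registers from [free] on are scratch and zero, so
   that [free] itself can stand for a missing argument. *)
Fixpoint compile (e : rfun) (args : seq nat) (out free : nat) : cmd :=
  match e with
  | RZero => Skip
  | RSucc => Seq (copy (nth free args 0) free.+1 out) (Inc out)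
  | RProj i => copy (nth free args i) free.+1 out
  | ROracle =>
      Seq (copy (nth free args 0) free.+2 free.+1)
      (Seq (Inc free.+1) (Seq (Ask free.+1 out) (clear free.+1)))
  | RComp g hs =>
      let m := size hs in
      Seq ((fix compiles hs p : cmd :=
        if hs is h :: hs' then Seq (compile h args p (free + m)) (compiles hs' p.+1)
        else Skip) hs free)
      (Seq (compile g (iota free m) out (free + m)) (clears free m))
  | RPrimRec b s =>
      let i := free.+1 in let acc := free.+2 in let res := free.+3 in
      let rem := free.+4 in let tmp := free.+4.+1 in let free' := free.+4.+2 in
      Seq (copy (nth free args 0) tmp rem)
      (Seq (compile b (behead args) acc free')
      (Seq (Loop rem (Seq (compile s [:: i, acc & behead args] res free')
                     (Seq (clear acc) (Seq (move res acc) (Inc i)))))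
      (Seq (move acc out) (clear i))))
  | RMu g =>
      let body := compile g (out :: args) free free.+1 in
      Seq body (Loop free (Seq (clear free) (Seq (Inc out) body)))
  end.

Definition compiles (args : seq nat) (top : nat) := fix compiles hs p : cmd :=
  if hs is h :: hs' then Seq (compile h args p top) (compiles hs' p.+1) else Skip.

Definition frame (args : seq nat) (out free : nat) (v : seq nat) (rho : regs) : Prop :=
  [/\ all (fun a => a < free) args, out < free, out \notin args,
      (rho out = 0) /\ (forall j, free <= j -> rho j = 0) & [seq rho a | a <- args] = v].

Variable C : nat -> bool.
(* Shifted by one because cell 0 of the oracle tape is part of the displayed word. *)
Hypothesis oC : forall j, o j.+1 = C j.

Definition compile_ok (e : rfun) : Prop := forall v r args out free rho,
  reval C e v r -> frame args out free v rho ->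
  exec o (compile e args out free) rho (upd rho out r).

Lemma frame_nth args out free v rho i : frame args out free v rho ->
  [/\ nth free args i <= free, nth free args i <> out & rho (nth free args i) = nth 0 v i].
Proof.
move=> [/allP Hargs Ho oargs [o0 z] <-].
case: (ltnP i (size args)) => Hi; last first.
  by rewrite !nth_default ?size_map //; split=> //; [lia | apply: z].
rewrite (nth_map free) //; have Hin := mem_nth free Hi.
split=> //; first exact/ltnW/Hargs.
by move=> E; rewrite -E Hin in oargs.
Qed.

Definition writes (rho : regs) (p : nat) (ws : seq nat) : regs :=
  fun j => if p <= j < p + size ws then nth 0 ws (j - p) else rho j.

Lemma exec_clears p m rho : exec o (clears p m) rho (writes rho p (nseq m 0)).
Proof.
elim: m p rho => [|m IH] p rho /=.
  apply: exec_eq; first exact: exec_skip.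
  by apply: functional_extensionality => j; rewrite /writes /=; case: ifP => //; lia.
apply: exec_eq; first exact: exec_seq (exec_clear _ _) (IH _ _).
have nth_0 n i : nth 0 (nseq n 0) i = 0 by rewrite nth_nseq if_same.
apply: functional_extensionality => j; rewrite /writes /upd !size_nseq /=.
rewrite -[0 :: nseq m 0]/(nseq m.+1 0) !nth_0 size_nseq.
by case: eqP; case: ifP; case: ifP => //; lia.
Qed.

Lemma revals_size hs v ws : revals C hs v ws -> size ws = size hs.
Proof.
elim: hs ws => [|h hs IH] ws E; inversion E as [|? ? ? w ws' ? Es]; subst => //=.
by rewrite (IH _ Es).
Qed.

Lemma exec_compiles args free top v hs ws p rho :
  foldr (fun h Q => compile_ok h /\ Q) True hs -> revals C hs v ws ->
  all (fun a => a < free) args -> free <= p -> p + size hs = top ->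
  (forall j, p <= j -> rho j = 0) -> [seq rho a | a <- args] = v ->
  exec o (compiles args top hs p) rho (writes rho p ws).
Proof.
move=> IHhs E args_lt; have /allP args_ltP := args_lt.
elim: hs ws p rho IHhs E => [|h hs IH] ws p rho /= IHhs E le_p size_p z rhov.
  inversion E; subst; apply: exec_eq; first exact: exec_skip.
  by apply: functional_extensionality => j; rewrite /writes addn0; case: ifP; lia.
move: IHhs => [ok_h oks]; inversion E as [|? ? ? w ws' Eh Es]; subst.
apply: exec_eq.
  apply: exec_seq; last apply: (IH _ _ _ oks Es); try lia.
  - apply: (ok_h _ _ _ _ _ _ Eh); split=> //; try lia.
    + by apply/allP => a /args_ltP; lia.
    + by apply/negP => /args_ltP; lia.
    + by split=> [|j Hj]; apply: z; lia.
  - by move=> j Hj; rewrite /upd; case: eqP => [|_]; [lia | apply: z; lia].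
  - apply/eq_in_map => a /args_ltP Ha; rewrite /upd; case: eqP => //; lia.
apply: functional_extensionality => j; rewrite /writes /upd /=.
case: eqP => [->|Hj]; first by rewrite subnn ltnn leqnn addnS ltnS leq_addr.
case: ifP; case: ifP => //; try lia.
by move=> ? ?; have -> : j - p = (j - p.+1).+1 by lia.
Qed.

Lemma primrec_trace b s v r : reval C (RPrimRec b s) v r ->
  exists f, [/\ reval C b (behead v) (f 0),
    forall i, i < nth 0 v 0 -> reval C s [:: i, f i & behead v] (f i.+1)
    & f (nth 0 v 0) = r].
Proof.
have main n v' r' : reval C (RPrimRec b s) (n :: v') r' ->
    exists f, [/\ reval C b v' (f 0),
      forall i, i < n -> reval C s [:: i, f i & v'] (f i.+1) & f n = r'].
  elim: n r' => [|n IH] r' E.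
    by inversion E; subst; exists (fun=> r').
  inversion E as [| | | | | |? ? ? ? a ? Er Es| |]; subst.
  have [f [Hb Hs fa]] := IH _ Er.
  exists (fun i => if i == n.+1 then r' else f i); rewrite eqxx; split=> // i Hi.
  rewrite eqSS; case: (eqVneq i n) Hi => [-> _|ne Hi]; first by rewrite ltn_eqF ?fa.
  by rewrite ltn_eqF //; apply: Hs; lia.
move=> E; case: v E => [|n v'] E; last exact: main.
by inversion E as [| | | | | | |? ? ? Er|]; subst; apply: (main 0 [::]).
Qed.

Lemma compile_exec e : compile_ok e.
Proof.
elim/rfun_nested_ind: e => [||i||g hs IHg IHhs|b s IHb IHs|g IHg] v r args out free rho E fr;
  have [args_lt out_lt oargs [out0 z] rhov] := fr.
- inversion E; subst; apply: exec_eq; first exact: exec_skip.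
  by regs_ext.
- inversion E; subst; have [/= a_le a_out a_val] := frame_nth 0 fr.
  apply: exec_eq.
    by apply: (exec_seq (exec_copy _ _ _ _) (exec_inc _ _ _)); rewrite ?z; lia.
  by rewrite out0 a_val nth0; regs_ext.
- inversion E; subst; have [/= a_le a_out a_val] := frame_nth i fr.
  apply: exec_eq; first by apply: exec_copy; rewrite ?z; lia.
  by rewrite out0 a_val; regs_ext.
- inversion E; subst; have [/= a_le a_out a_val] := frame_nth 0 fr.
  apply: exec_eq.
    apply: (exec_seq (exec_copy _ _ _ _) (exec_seq (exec_inc _ _ _)
      (exec_seq (exec_ask _ _ _ _) (exec_clear _ _)))); rewrite ?z; lia.
  have z1 : rho free.+1 = 0 by apply: z; lia.
  rewrite -nth0 -a_val -oC; apply: functional_extensionality => j.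
  rewrite /upd !eqxx /= z1 add0n; case: (eqVneq j free.+1) => [->|_].
    by case: eqP => //; lia.
  case: (eqVneq j out) => // _; case: eqP => [?|_]; first lia.
  by rewrite out0; case: o.
- inversion E as [| | | |? ? ? ws ? Es Eg| | | |]; subst => /=.
  set m := size hs.
  have size_ws : size ws = m := revals_size Es.
  have Hc := exec_compiles IHhs Es args_lt (leqnn free) (erefl (free + m)) z erefl.
  have Hg : exec o (compile g (iota free m) out (free + m)) (writes rho free ws)
      (upd (writes rho free ws) out r).
    apply: (IHg _ _ _ _ _ _ Eg); split.
    - by apply/allP => a; rewrite mem_iota => /andP[].
    - lia.
    - by rewrite mem_iota; lia.
    - split=> [|j Hj]; rewrite /writes size_ws; case: ifP => //; try lia.
      by move=> _; apply: z; lia.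
    - apply: (@eq_from_nth _ 0); first by rewrite size_map size_iota.
      move=> i; rewrite size_map size_iota => Hi.
      rewrite (nth_map 0) ?size_iota // nth_iota // /writes size_ws addKn.
      by case: ifP => //; lia.
  apply: exec_eq; first exact: exec_seq Hc (exec_seq Hg (exec_clears _ _ _)).
  apply: functional_extensionality => j; rewrite /writes /upd size_nseq size_ws.
  rewrite nth_nseq if_same; case: ifP => Hj; last by rewrite Hj.
  by case: eqP => [|_]; [lia | rewrite z //; lia].
- have [f [Hb Hs <-]] := primrec_trace E.
  have [] := frame_nth 0 fr; move: Hs; set n := nth 0 v 0; move=> Hs.
  move=> /=; set a := nth free args 0 => a_le a_out a_val.
  have /allP args_ltP := args_lt.
  set ri := free.+1; set acc := free.+2; set res := free.+3.
  set rem := free.+4; set tmp := free.+4.+1; set free' := free.+4.+2.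
  pose st k := upd (upd (upd rho ri k) acc (f k)) rem (n - k).
  have stE k j : j < free -> st k j = rho j.
    by move=> Hj; rewrite /st /upd; repeat (case: eqP => [?|_]; first lia).
  have st0 k j : res <= j -> j <> rem -> st k j = 0.
    by move=> Hj Hr; rewrite /st /upd; repeat (case: eqP => [?|_]; first lia); apply: z; lia.
  have beh x : x \in behead args -> x < free.
    by move=> /mem_behead/args_ltP.
  have Hcopy : exec o (copy a tmp rem) rho (upd rho rem n).
    apply: exec_eq; first by apply: exec_copy; rewrite ?z; lia.
    by rewrite z ?a_val; last lia.
  have rhob : [seq rho x | x <- behead args] = behead v by rewrite -behead_map rhov.
  have Hbase : exec o (compile b (behead args) acc free') (upd rho rem n) (st 0).
    apply: exec_eq.
      apply: (IHb _ _ _ _ _ _ Hb); split.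
      - by apply/allP => x /beh; lia.
      - by lia.
      - by apply/negP => /beh; lia.
      - by split=> [|j Hj]; rewrite /upd; (case: eqP => [?|_]; first lia); apply: z; lia.
      - by rewrite -rhob; apply/eq_in_map => x /beh Hx; rewrite /upd; case: eqP; lia.
    have zri : rho ri = 0 by apply: z; lia.
    by rewrite /st subn0; regs_ext.
  pose body := Seq (compile s [:: ri, acc & behead args] res free')
                     (Seq (clear acc) (Seq (move res acc) (Inc ri))).
  have Hstep k : k < n -> exec o body (upd (st k) rem (n - k.+1)) (st k.+1).
    move=> Hk; apply: exec_eq.
      apply: exec_seq.
        apply: (IHs _ _ _ _ _ _ (Hs k Hk)); split.
        - by apply/and3P; split; try lia; apply/allP => x /beh; lia.
        - lia.
        - by rewrite !inE; apply/negP => /or3P[/eqP|/eqP|/beh]; lia.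
        - by split=> [|j Hj]; rewrite /upd; (case: eqP => [?|_]; first lia); apply: st0; lia.
        - rewrite /= -rhob; congr [:: _, _ & _].
          + by rewrite /st /upd; repeat (case: eqP => ? //; try lia).
          + by rewrite /st /upd; repeat (case: eqP => ? //; try lia).
          + apply/eq_in_map => x /beh Hx; rewrite -(stE k) // /upd; case: eqP => //; lia.
      apply: exec_seq (exec_clear _ _) (exec_seq (exec_move _ _) (exec_inc _ _ _)); lia.
    have zres : rho res = 0 by apply: z; lia.
      by rewrite /st; regs_ext.
  have Hloop d k : k + d = n -> exec o (Loop rem body) (st k) (st n).
    elim: d k => [|d IH] k Hk.
      have -> : k = n by lia.
      by apply: exec_loop0; rewrite /st /upd eqxx subnn.
    apply: (@exec_loopS _ _ _ _ (st k.+1) _ (n - k.+1)); last by apply: IH; lia.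
      by rewrite /st /upd eqxx; lia.
    by apply: Hstep; lia.
  apply: exec_eq.
    apply: (exec_seq Hcopy (exec_seq Hbase (exec_seq (Hloop n 0 (add0n n)) _))).
    by apply: exec_seq (exec_move _ _) (exec_clear _ _); lia.
  have [zri zacc zrem] : [/\ rho ri = 0, rho acc = 0 & rho rem = 0].
    by split; apply: z; lia.
  by rewrite /st; regs_ext.
- inversion E as [| | | | | | | |? ? ? En Em]; subst.
  set v := [seq rho a | a <- args] in E En Em fr *.
  have /allP args_ltP := args_lt; have nout a : a \in args -> a <> out.
    by move=> Ha Ea; rewrite -Ea Ha in oargs.
  pose st k := upd rho out k.
  have Hbody k q : reval C g (k :: v) q ->
      exec o (compile g (out :: args) free free.+1) (st k) (upd (st k) free q).
    move=> Eg; apply: (IHg _ _ _ _ _ _ Eg); split.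
    - by apply/andP; split; [lia | apply/allP => a /args_ltP; lia].
    - lia.
    - by rewrite inE; apply/negP => /orP[/eqP|/args_ltP]; lia.
    - by split=> [|j Hj]; rewrite /st /upd; (case: eqP => [?|_]; first lia); apply: z; lia.
    - rewrite /= {1}/st /upd eqxx; congr (_ :: _).
      by apply/eq_in_map => a /nout; rewrite /st /upd; case: eqP.
  have Hloop d k q : k + d = r -> reval C g (k :: v) q ->
      exec o (Loop free (Seq (clear free) (Seq (Inc out)
        (compile g (out :: args) free free.+1)))) (upd (st k) free q) (st r).
    elim: d k q => [|d IH] k q Hk Eg.
      have Er : k = r by lia.
      move: Eg; rewrite Er => /reval_fun/(_ _ En) ->.
      apply: exec_eq; first by apply: exec_loop0; rewrite /upd eqxx.
      by have zf : rho free = 0 by [apply: z]; rewrite /st; regs_ext.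
    have [q' Eg' q'0] : exists2 q', reval C g (k :: v) q' & q' <> 0 by apply: Em; lia.
    have [q'' Eg''] : exists q'', reval C g (k.+1 :: v) q''.
      case: d Hk {IH} => [|d] Hk; first by exists 0; have -> : k.+1 = r by lia.
      by have [|q'' ? _] := Em k.+1; [lia | exists q''].
    rewrite (reval_fun Eg Eg'); case: q' Eg' q'0 => // q' _ _.
    apply: (@exec_loopS _ _ _ _ (upd (st k.+1) free q'') _ q').
    - by rewrite /upd eqxx.
    - apply: exec_eq.
        apply: exec_seq (exec_clear _ _) (exec_seq (exec_inc _ _ _) _).
        have -> : upd (upd (upd (upd (st k) free q'.+1) free q') free 0) out
            (upd (upd (upd (st k) free q'.+1) free q') free 0 out).+1 = st k.+1.
          by have zf : rho free = 0 by [apply: z]; rewrite /st; regs_ext.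
        exact: Hbody Eg''.
      by [].
    - by apply: IH; [lia|].
  have [q Eq] : exists q, reval C g (0 :: v) q.
    case: (posnP r) => [r0|r_gt0]; first by exists 0; rewrite -{1}r0.
    by have [q ? _] := Em 0 r_gt0; exists q.
  have st0 : st 0 = rho by rewrite /st; regs_ext.
  apply: exec_seq (Hloop r 0 q (add0n r) Eq).
  by rewrite -{1}st0; apply: Hbody.
Qed.
End Exec.

(** * Register machines *)

Inductive instr : Type :=
| INC (i j : nat)
| DEC (i j0 j1 : nat)
| QRY (i j0 j1 : nat).

Definition mstate := (nat * regs)%type.

Definition mstep (o : nat -> bool) (prog : nat -> instr) (s : mstate) : mstate :=
  match prog s.1 with
  | INC i j => (j, upd s.2 i (s.2 i).+1)
  | DEC i j0 j1 => if s.2 i is n.+1 then (j1, upd s.2 i n) else (j0, s.2)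
  | QRY i j0 j1 => (if (i != 0) && o (s.2 i) then j1 else j0, s.2)
  end.

Fixpoint csize (c : cmd) : nat :=
  match c with
  | Skip => 0
  | Seq c d => csize c + csize d
  | Inc _ => 1
  | Ask _ _ => 2
  | Loop _ c => (csize c).+2
  | IfDec _ c d => (csize c + csize d).+2
  end.

Fixpoint assemble (c : cmd) (off : nat) : seq instr :=
  match c with
  | Skip => [::]
  | Seq c d => assemble c off ++ assemble d (off + csize c)
  | Inc i => [:: INC i off.+1]
  | Ask i j => [:: QRY i off.+2 off.+1; INC j off.+2]
  | Loop i c => DEC i (off + csize c).+2 off.+1 :: assemble c off.+1 ++ [:: QRY i off off]
  | IfDec i c d =>
      let fin := (off + csize c + csize d).+2 in
      DEC i (off + csize c).+2 off.+1 :: assemble c off.+1 ++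
        QRY i fin fin :: assemble d (off + csize c).+2
  end.

Lemma size_assemble c off : size (assemble c off) = csize c.
Proof.
elim: c off => //= [c IHc d IHd|i c IHc|i c IHc d IHd] off.
- by rewrite size_cat IHc IHd.
- by rewrite size_cat IHc addn1.
- by rewrite size_cat /= IHc IHd addnS.
Qed.

Fixpoint code_at (prog : nat -> instr) (off : nat) (l : seq instr) : Prop :=
  if l is x :: l' then prog off = x /\ code_at prog off.+1 l' else True.

Lemma code_at_cat prog off l1 l2 :
  code_at prog off (l1 ++ l2) <-> code_at prog off l1 /\ code_at prog (off + size l1) l2.
Proof.
elim: l1 off => [|x l1 IH] off /=; first by rewrite addn0; split=> [|[]].
by rewrite IH addSnnS; split=> [[? []]|[[]]].
Qed.

Lemma code_at_nth d pre l post :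
  code_at (nth d (pre ++ l ++ post)) (size pre) l.
Proof.
elim: l pre => //= x l IH pre; split; first by rewrite nth_cat ltnn subnn.
by have := IH (rcons pre x); rewrite size_rcons cat_rcons.
Qed.

Section Run.
Variables (o : nat -> bool) (prog : nat -> instr).
Let step := mstep o prog.

Definition run (m : nat) (s s' : mstate) : Prop :=
  iter m step s = s' /\ forall j, j < m -> (iter j step s).1 <> 0.
Definition reach (s s' : mstate) : Prop := exists m, run m s s'.

Lemma run_trans m1 m2 s s' s'' : run m1 s s' -> run m2 s' s'' -> run (m2 + m1) s s''.
Proof.
move=> [E1 H1] [E2 H2]; split=> [|j Hj]; first by rewrite iterD E1.
case: (ltnP j m1) => [/H1 //|le_j].
by have := H2 (j - m1); rewrite -E1 -iterD subnK //; apply; lia.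
Qed.

Lemma run1 s s' : s.1 <> 0 -> step s = s' -> run 1 s s'.
Proof. by move=> s0 ss'; split=> // -[]. Qed.

Lemma reach_refl s : reach s s.
Proof. by exists 0. Qed.

Lemma reach_trans s s' s'' : reach s s' -> reach s' s'' -> reach s s''.
Proof. by move=> [m1 R1] [m2 R2]; exists (m2 + m1); apply: run_trans R1 R2. Qed.

Lemma reach_step s s' : s.1 <> 0 -> reach (step s) s' -> reach s s'.
Proof. by move=> s0; apply: reach_trans; exists 1; apply: run1. Qed.

Lemma assemble_reach c rho rho' : exec o c rho rho' ->
  forall off, 0 < off -> code_at prog off (assemble c off) ->
  reach (off, rho) (off + csize c, rho').
Proof.
elim=> {c rho rho'}
  [rho|c d rho rho' rho'' _ IHc _ IHd|i rho|i j rho|i c rho E|i c rho rho' rho'' n E _ IHc _ IHl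
  |i c d rho rho' E _ IHd|i c d rho rho' n E _ IHc] off Hoff /=.
- by rewrite addn0 => _; apply: reach_refl.
- rewrite code_at_cat size_assemble => -[Hc Hd]; rewrite addnA.
  by apply: reach_trans (IHc _ _ Hc) (IHd _ _ Hd) => //; lia.
- move=> [E _]; apply: reach_step => /=; first lia.
  by rewrite /step /mstep /= E addn1; apply: reach_refl.
- move=> [E1 [E2 _]]; apply: reach_step => /=; first lia.
  rewrite /step {1}/mstep /= E1; case: (_ && _) => /=.
    apply: reach_step => //=.
    by rewrite /step /mstep /= E2 addn1 addn2; apply: reach_refl.
  rewrite addn0 addn2 (_ : upd rho j (rho j) = rho); first exact: reach_refl.
  by regs_ext.
- move=> [E1 _]; apply: reach_step => /=; first lia.
  by rewrite /step /mstep /= E1 E !addnS; apply: reach_refl.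
- move=> [E1 H]; apply: reach_step => /=; first lia.
  rewrite /step {1}/mstep /= E1 E; move: (H); rewrite code_at_cat size_assemble => -[Hc [E2 _]].
  apply: reach_trans (IHc _ _ Hc) _ => //; apply: reach_step => //.
  rewrite /step {1}/mstep /= E2 if_same; exact: IHl.
- move=> [E1]; rewrite code_at_cat size_assemble /= => -[_ [_ Hd]].
  apply: reach_step => /=; first lia.
  rewrite /step {1}/mstep /= E1 E.
  have -> : off + (csize c + csize d).+2 = (off + csize c).+2 + csize d by lia.
  apply: IHd => //; move: Hd; rewrite addSn; exact.
- move=> [E1]; rewrite code_at_cat size_assemble /= => -[Hc [E2 _]].
  apply: reach_step => /=; first lia.
  rewrite /step {1}/mstep /= E1 E; apply: reach_trans (IHc _ _ Hc) _ => //.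
  apply: reach_step => //; rewrite /step {1}/mstep /= E2 if_same.
  have -> : off + (csize c + csize d).+2 = (off + csize c + csize d).+2 by lia.
  exact: reach_refl.
Qed.

Definition stalls (s : mstate) : Prop :=
  exists K, forall k, K <= k -> (iter k step s).1 <> 0.

Lemma stalls_iter m s : stalls (iter m step s) -> stalls s.
Proof.
move=> [K HK]; exists (K + m) => k Hk.
by have := HK (k - m); rewrite -iterD subnK; [apply; lia | lia].
Qed.

Lemma stalls_reach s s' : reach s s' -> stalls s' -> stalls s.
Proof. by move=> [m [<- _]]; apply: stalls_iter. Qed.

Lemma avoid_invariant (I : mstate -> Prop) s :
  (forall s, I s -> exists m s', [/\ 0 < m, run m s s' & I s']) -> I s ->
  forall k, (iter k step s).1 <> 0.
Proof.
move=> HI Is k; have [n] := ubnP k; elim: n s k Is => // n IH s k Is Hk.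
have [m [s' [m_gt0 [Es' Hm] Is']]] := HI _ Is.
case: (ltnP k m) => [/Hm //|le_mk].
by have := IH _ (k - m) Is'; rewrite -Es' -iterD subnK //; apply; lia.
Qed.
End Run.

(** * The recurrent search *)

Section Search.
Variable e : rfun.
Hypothesis e_total : forall (C : nat -> bool) m l w, exists r, reval C e [:: m; l; w] r.

(* Registers: 0 input, 1 and 2 the bounds [a] and [b], 3 the witness [l],
   4 a flag, 5 the value of [e].  Instruction 0 is executed each time the
   values of [a] have been checked down to 0; the next round starts from
   [b + 1], so every value is checked if the program never stalls. *)
Definition refill : cmd := move 2 1.
Definition check : cmd :=
  Seq (compile e [:: 1; 3; 0] 5 6)
  (IfDec 5 (Seq (clear 5) (Inc 3)) (Seq (clear 3) (IfDec 1 (Inc 2) (Inc 4)))).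
Definition check_pc : nat := 1 + csize refill.
Definition search : seq instr :=
  INC 2 1 :: assemble refill 1 ++ assemble check check_pc ++ [:: DEC 4 check_pc 0].
Definition search_prog (j : nat) : instr := nth (INC 0 0) search j.

Definition round_regs (n a b l : nat) : regs :=
  fun j => match j with 0 => n | 1 => a | 2 => b | 3 => l | _ => 0 end.

Variables (o C : nat -> bool) (n : nat).
Hypothesis oC : forall j, o j.+1 = C j.
Let step := mstep o search_prog.

Definition display_state (b : nat) : mstate := (0, round_regs n 0 b 0).
Let check_state a b l : mstate := (check_pc, round_regs n a b l).

Lemma refill_code : code_at search_prog 1 (assemble refill 1).
Proof. exact: (code_at_nth _ [:: _]). Qed.

Lemma check_code : code_at search_prog check_pc (assemble check check_pc).
Proof.
exact: (code_at_nth (INC 0 0) (INC 2 1 :: assemble refill 1)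
  (assemble check check_pc) [:: DEC 4 check_pc 0]).
Qed.

Lemma check_end : search_prog (check_pc + csize check) = DEC 4 check_pc 0.
Proof.
rewrite /search_prog /search -cat_cons catA nth_cat size_cat size_assemble.
by rewrite (_ : size (_ :: assemble refill 1) = check_pc) // ltnn subnn.
Qed.

Lemma display_run b : reach o search_prog (step (display_state b)) (check_state b.+1 0 0).
Proof.
have Hr : exec o refill (round_regs n 0 b.+1 0) (round_regs n b.+1 0 0).
  apply: exec_eq; first exact: exec_move.
  by apply: functional_extensionality; case=> [|[|[|[|[]]]]].
have := assemble_reach Hr (ltn0Sn 0) refill_code.
rewrite /step /mstep /= (_ : upd _ 2 _ = round_regs n 0 b.+1 0) //.
by apply: functional_extensionality; case=> [|[|[|[|[]]]]].
Qed.

Lemma check_exec a b l r rho' : reval C e [:: a; l; n] r ->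
  exec o (IfDec 5 (Seq (clear 5) (Inc 3)) (Seq (clear 3) (IfDec 1 (Inc 2) (Inc 4))))
    (upd (round_regs n a b l) 5 r) rho' ->
  exec o check (round_regs n a b l) rho'.
Proof.
move=> E; apply: exec_seq; apply: (compile_exec oC) E _.
by split=> //; split=> // -[|[|[|[|[|[|?]]]]]].
Qed.

Lemma check_run a b l rho' : exec o check (round_regs n a b l) rho' ->
  exists m, run o search_prog m.+1 (check_state a b l) (step (check_pc + csize check, rho')).
Proof.
move=> E; have [m Hm] := assemble_reach E (ltn0Sn _) check_code; exists m.
by rewrite -add1n; apply: run_trans Hm (run1 _ _).
Qed.

Lemma check_fail a b l r : reval C e [:: a; l; n] r.+1 ->
  exists m, run o search_prog m.+1 (check_state a b l) (check_state a b l.+1).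
Proof.
move=> E; have [] := check_run (rho' := round_regs n a b l.+1) (b := b) (l := l) (a := a).
  apply: check_exec E _; apply: exec_ifS; first exact: erefl.
  apply: exec_eq; first exact: exec_seq (exec_clear _ _ _) (exec_inc _ _ _).
  by apply: functional_extensionality; case=> [|[|[|[|[|[]]]]]].
by move=> m Hm; exists m; move: Hm; rewrite /step /mstep check_end.
Qed.

Lemma check_next a b l : reval C e [:: a.+1; l; n] 0 ->
  reach o search_prog (check_state a.+1 b l) (check_state a b.+1 0).
Proof.
move=> E; have [] := check_run (rho' := round_regs n a b.+1 0) (b := b) (l := l) (a := a.+1).
  apply: check_exec E _; apply: exec_if0; first exact: erefl.
  apply: exec_eq.
    by apply: exec_seq (exec_clear _ _ _) (exec_ifS _ _ (exec_inc _ _ _)); first exact: erefl.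
  by apply: functional_extensionality; case=> [|[|[|[|[|[]]]]]].
by move=> m Hm; exists m.+1; move: Hm; rewrite /step /mstep check_end.
Qed.

Lemma check_display b l : reval C e [:: 0; l; n] 0 ->
  reach o search_prog (check_state 0 b l) (display_state b).
Proof.
move=> E; have [] := check_run (rho' := upd (round_regs n 0 b 0) 4 1) (b := b) (l := l) (a := 0).
  apply: check_exec E _; apply: exec_if0; first exact: erefl.
  apply: exec_eq.
    by apply: exec_seq (exec_clear _ _ _) (exec_if0 _ _ (exec_inc _ _ _)); exact: erefl.
  by apply: functional_extensionality; case=> [|[|[|[|[|[]]]]]].
move=> m Hm; exists m.+1; move: Hm; rewrite /step /mstep check_end /=.
rewrite (_ : upd _ 4 0 = round_regs n 0 b 0) //.
by apply: functional_extensionality; case=> [|[|[|[|[|[]]]]]].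
Qed.

Lemma search_witness a b l0 l : l0 <= l -> reval C e [:: a; l; n] 0 ->
  exists2 l', reval C e [:: a; l'; n] 0 &
    reach o search_prog (check_state a b l0) (check_state a b l').
Proof.
move=> le_l E; have [d] := ubnP (l - l0); elim: d l0 le_l => // d IH l0 le_l Hd.
have [[|r] Er] := e_total C a l0 n; first by exists l0 => //; apply: reach_refl.
have lt_l : l0 < l.
  rewrite ltn_neqAle le_l andbT; apply/eqP => El.
  by move: E; rewrite -El => /(reval_fun Er).
have [||l' El' Hl'] := IH l0.+1; [lia | lia |].
exists l' => //; apply: reach_trans Hl'.
by have [m Hm] := check_fail b Er; exists m.+1.
Qed.

Lemma display_next b : (forall a, exists l, reval C e [:: a; l; n] 0) ->
  exists2 m, 0 < m & iter m step (display_state b) = display_state b.+1.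
Proof.
move=> HC.
have H a c : reach o search_prog (check_state a c 0) (display_state (a + c)).
  elim: a c => [|a IH] c.
    have [l El] := HC 0; have [l' El' R] := search_witness c (leq0n l) El.
    exact: (reach_trans R (check_display c El')).
  have [l El] := HC a.+1; have [l' El' R] := search_witness c (leq0n l) El.
  apply: (reach_trans R (reach_trans (check_next c El') _)).
  by rewrite addSnnS; apply: IH.
have [m [Em _]] := reach_trans (display_run b) (H b.+1 0).
by exists m.+1 => //; rewrite iterSr Em addn0.
Qed.

Lemma display_unbounded : (forall a, exists l, reval C e [:: a; l; n] 0) ->
  forall b, exists2 m, b <= m & iter m step (display_state 1) = display_state b.+1.
Proof.
move=> HC; elim=> [|b [m le_m Em]]; first by exists 0.
have [m' m'_gt0 Em'] := display_next b.+1 HC.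
by exists (m' + m); [lia | rewrite iterD Em].
Qed.

Lemma display_stalls b : ~ (forall a, exists l, reval C e [:: a; l; n] 0) ->
  stalls o search_prog (display_state b).
Proof.
move=> /not_all_ex_not[bad Hbad].
have stuck a c l : (forall l', ~ reval C e [:: a; l'; n] 0) ->
    stalls o search_prog (check_state a c l).
  move=> Ha; exists 0 => k _.
  apply: (avoid_invariant (I := fun s => exists l', s = check_state a c l')); last by exists l.
  move=> _ [l' ->]; have [[|r] Er] := e_total C a l' n; first by case: (Ha l').
  by have [m Hm] := check_fail c Er; exists m.+1, (check_state a c l'.+1); split=> //; exists l'.+1.
have Hc a c : (a < bad -> stalls o search_prog (display_state (a + c))) ->
    stalls o search_prog (check_state a c 0).
  elim: a c => [|a IH] c Hd.
    case: (classic (exists l, reval C e [:: 0; l; n] 0)) => [[l El]|Ha]; last first.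
      by apply: stuck => l' El; apply: Ha; exists l'.
    have [l' El' R] := search_witness c (leq0n l) El.
    apply: (stalls_reach R (stalls_reach (check_display c El') (Hd _))).
    by rewrite lt0n; apply/eqP => bad0; apply: Hbad; rewrite bad0; exists l.
  case: (classic (exists l, reval C e [:: a.+1; l; n] 0)) => [[l El]|Ha]; last first.
    by apply: stuck => l' El; apply: Ha; exists l'.
  have [l' El' R] := search_witness c (leq0n l) El.
  apply: (stalls_reach R (stalls_reach (check_next c El') (IH _ _))) => lt_a.
  rewrite addnS -addSn; apply: Hd; rewrite ltn_neqAle lt_a andbT.
  by apply/eqP => Ea; apply: Hbad; rewrite -Ea; exists l.
have [d] := ubnP (bad - b); elim: d b => // d IH b Hd.
apply: (stalls_iter (m := 1)); apply: (stalls_reach (display_run b) (Hc _ _ _)) => lt_b.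
by rewrite addn0; apply: IH; lia.
Qed.
End Search.

(** * The cellular automaton *)

(* [Out]: looking for the end of the unary register of the current instruction;
   [Clr]: about to erase its last digit; [Back]: returning to the origin. *)
Definition Out : option bool := None.
Definition Clr : option bool := Some true.
Definition Back : option bool := Some false.

Ltac zcases := repeat match goal with
  | |- context [(?a =? ?b)%Z] => case: (Z.eqb_spec a b) => ? //=
  | |- context [(?a <? ?b)%Z] => case: (Z.ltb_spec a b) => ? //=
  end; try lia.

Section Automaton.
Variables (K : nat) (prog : nat -> instr).
Notation Q := 'I_K.+1.

(* A cell carries its side of the origin ([None] at the origin, otherwise
   whether it lies to the right), the head or the direction towards it
   ([true] for right), a digit of each register and a digit of the oracle. *)
Definition head : Type := (option bool * Q)%type.
Definition digits : Type := {ffun Q -> bool}.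
Definition cell : Type := (option bool * (bool + head) * digits * bool)%type.

Definition side_of (c : cell) := c.1.1.1.
Definition head_of (c : cell) := c.1.1.2.
Definition digits_of (c : cell) : digits := c.1.2.

Definition side_ok (a b : option bool) : bool :=
  match a, b with
  | Some false, Some false | Some false, None | None, Some true | Some true, Some true => true
  | _, _ => false
  end.
Definition head_ok (a b : bool + head) : bool :=
  match a, b with
  | inl true, inl true | inl true, inr _ | inr _, inl false | inl false, inl false => true
  | _, _ => false
  end.
(* Register 0 extends to the right of the origin, the other ones to the left. *)
Definition digits_ok (a b : digits) : bool :=
  [forall i : Q, if i == ord0 then b i ==> a i else a i ==> b i].
Definition ok (a b : cell) : bool :=
  [&& side_ok (side_of a) (side_of b), head_ok (head_of a) (head_of b)
    & digits_ok (digits_of a) (digits_of b)].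

Definition set_digit (L : digits) (i : Q) (v : bool) : digits :=
  [ffun j => if j == i then v else L j].

Definition toward (sd : option bool) : option bool := omap negb sd.

(* New digits, move ([Some true] for right) and new state of the head. *)
Definition act (sd : option bool) (hd : head) (L : digits) (ob : bool)
  : digits * option bool * head :=
  let: (ph, q) := hd in
  let away (i : nat) := (L, Some (i == 0), (Out, q)) in
  match ph with
  | None =>
      match prog q with
      | INC i j =>
          if L (inord i) then away i else (set_digit L (inord i) true, None, (Back, inord j))
      | DEC i j0 j1 =>
          if L (inord i) then away i
          else if sd is None then (L, None, (Back, inord j0)) else (L, toward sd, (Clr, q))
      | QRY i j0 j1 =>
          if L (inord i) then away i
          else (L, None, (Back, inord (if (i != 0) && ob then j1 else j0)))
      end
  | Some true =>
      if prog q is DEC i j0 j1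
      then (set_digit L (inord i) false, None, (Back, inord j1)) else (L, None, (Back, q))
  | Some false =>
      if sd is None then (L, None, (Out, q)) else (L, toward sd, (Back, q))
  end.

Definition cell_act (c : cell) : option (digits * option bool * head) :=
  if head_of c is inr hd then Some (act (side_of c) hd (digits_of c) c.2) else None.

Definition incoming (d : bool) (c : cell) : option head :=
  if cell_act c is Some (_, Some d', hd) then if d == d' then Some hd else None else None.

Definition update (a b c : cell) : cell :=
  match cell_act b with
  | Some (L, mv, hd) => (side_of b, if mv is Some d then inl d else inr hd, L, b.2)
  | None =>
      let hd := if incoming true a is Some hd then inr hd
                else if incoming false c is Some hd then inr hd else head_of b in
      (side_of b, hd, digits_of b, b.2)
  end.

Definition rule (a b c : option cell) : option cell :=
  if (a, b, c) is (Some a, Some b, Some c) then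
    if ok a b && ok b c then Some (update a b c) else None
  else None.

Definition automaton : config (option cell) -> config (option cell) := local_map rule.

Definition side (z : Z) : option bool := if (z =? 0)%Z then None else Some (0 <? z)%Z.

Variable ora : Z -> bool.

Definition encode (h : Z) (hd : head) (L : Z -> digits) : config (option cell) :=
  fun z => Some (side z, if (z =? h)%Z then inr hd else inl (z <? h)%Z, L z, ora z).

Definition monotone (L : Z -> digits) : Prop := forall z, digits_ok (L z) (L (z + 1)%Z).

Definition moveZ (mv : option bool) : Z :=
  if mv is Some d then if d then 1%Z else (-1)%Z else 0%Z.

Definition updZ (L : Z -> digits) (h : Z) (l : digits) : Z -> digits :=
  fun z => if (z =? h)%Z then l else L z.

Lemma rule_encode h hd L : monotone L ->
  automaton (encode h hd L) =
  (let: (l, mv, hd') := act (side h) hd (L h) (ora h) in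
   encode (h + moveZ mv) hd' (updZ L h l)).
Proof.
move=> mono.
case E : (act _ _ _ _) => [[l mv] hd'].
apply: functional_extensionality => z; rewrite /automaton /local_map /rule {1 2 3}/encode.
set a := (side (z - 1), _, _, _); set b := (side z, _, _, _); set c := (side (z + 1), _, _, _).
have side_okZ y : side_ok (side y) (side (y + 1)).
  by rewrite /side; zcases.
have head_okZ y : head_ok (if (y =? h)%Z then inr hd else inl (y <? h)%Z)
    (if (y + 1 =? h)%Z then inr hd else inl (y + 1 <? h)%Z).
  by zcases.
have -> : ok a b.
  have := side_okZ (z - 1)%Z; have := head_okZ (z - 1)%Z; have := mono (z - 1)%Z.
  have -> : (z - 1 + 1 = z)%Z by lia.
  by rewrite /ok => -> -> ->.
have -> : ok b c by rewrite /ok side_okZ head_okZ mono.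
congr Some; rewrite /update /incoming /cell_act /head_of /side_of /digits_of /=.
rewrite /updZ.
case: (Z.eqb_spec z h) => [zh|zh].
  rewrite zh E; case: mv E => [[]|] _ /=.
  - by zcases.
  - by zcases.
  - by zcases.
case: (Z.eqb_spec (z - 1) h) => [zh1|zh1].
  rewrite zh1 E; case: mv E => [[]|] _ /=; case: (Z.eqb_spec (z + 1) h); try lia.
  - by zcases.
  - by move=> _; zcases.
  - by move=> _; zcases.
case: (Z.eqb_spec (z + 1) h) => [zh2|zh2] /=.
  rewrite zh2 E; case: mv E => [[]|] _ /=.
  - by zcases.
  - by zcases.
  - by zcases.
by case: mv {E} => [[]|] /=; zcases.
Qed.

Definition digits_of_regs (rho : regs) (z : Z) : digits :=
  [ffun i : Q => if i == ord0 then (z <? Z.of_nat (rho i))%Z else (- z <? Z.of_nat (rho i))%Z].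

Lemma monotone_regs rho : monotone (digits_of_regs rho).
Proof.
move=> z; apply/forallP => i; rewrite !ffunE; case: (i == ord0); zcases.
Qed.

Definition displays (X : config (option (cell))) : Prop :=
  exists c, X 0%Z = Some c /\ head_of c = inr (Out, ord0).

(* [A] guards the absence of displays, so that the same lemmas apply to the
   instruction that is displayed. *)
Definition ca_run (A : Prop) (m : nat) (X X' : config (option (cell))) : Prop :=
  iter m automaton X = X' /\
  (A -> forall j, j < m -> ~ displays (iter j automaton X)).

Lemma ca_run_trans A m1 m2 X X' X'' :
  ca_run A m1 X X' -> ca_run A m2 X' X'' -> ca_run A (m2 + m1) X X''.
Proof.
move=> [E1 H1] [E2 H2]; split=> [|hA j Hj]; first by rewrite iterD E1.
case: (ltnP j m1) => [|le_j]; first exact: H1.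
by have := H2 hA (j - m1); rewrite -E1 -iterD subnK //; apply; lia.
Qed.

Lemma ca_run1 A h hd L l mv hd' : monotone L -> (A -> hd <> (Out, ord0)) ->
  act (side h) hd (L h) (ora h) = (l, mv, hd') ->
  ca_run A 1 (encode h hd L) (encode (h + moveZ mv) hd' (updZ L h l)).
Proof.
move=> mono Ahd E; split=> [|hA [|//] _ /=]; first by rewrite /= rule_encode // E.
move=> [c [Ec Hc]]; move: Ec Hc; rewrite /encode => -[<-]; rewrite /head_of /=.
by case: ifP => // _ [/(Ahd hA)].
Qed.

Lemma updZ_id (L : Z -> digits) h : updZ L h (L h) = L.
Proof. by apply: functional_extensionality => z; rewrite /updZ; case: Z.eqb_spec => // ->. Qed.

Definition reg_of (x : instr) : nat :=
  match x with INC i _ | DEC i _ _ | QRY i _ _ => i end.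
Definition outward (i : nat) (j : nat) : Z := if i == 0 then Z.of_nat j else (- Z.of_nat j)%Z.

Hypothesis prog_bounded : forall q,
  match prog q with
  | INC i j => i <= K /\ j <= K
  | DEC i j0 j1 | QRY i j0 j1 => [/\ i <= K, j0 <= K & j1 <= K]
  end.

Lemma reg_bounded q : reg_of (prog q) <= K.
Proof. by have := prog_bounded q; case: (prog q) => [? ?|? ? ?|? ? ?] []. Qed.

Lemma inord_eq0 i : i <= K -> (inord i == ord0 :> Q) = (i == 0).
Proof. by move=> Hi; rewrite -val_eqE /= inordK. Qed.

Lemma digits_outward rho i j : i <= K ->
  digits_of_regs rho (outward i j) (inord i) = (j < rho i).
Proof.
move=> Hi; rewrite ffunE inord_eq0 // /outward inordK //.
by case: (i == 0); case: (ltnP j (rho i)) => ?; zcases.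
Qed.

Lemma act_away sd (q : Q) (L : digits) ob : L (inord (reg_of (prog q))) ->
  act sd (Out, q) L ob = (L, Some (reg_of (prog q) == 0), (Out, q)).
Proof. by rewrite /act /Out /=; case: (prog q) => [i j|i j0 j1|i j0 j1] /= ->. Qed.

Lemma walk_out (A : Prop) (q : Q) L m : monotone L -> (A -> q <> ord0) ->
  (forall j, j < m -> L (outward (reg_of (prog q)) j) (inord (reg_of (prog q)))) ->
  ca_run A m (encode 0 (Out, q) L) (encode (outward (reg_of (prog q)) m) (Out, q) L).
Proof.
move=> mono Aq; elim: m => [|m IH] Hm.
  by split=> //=; rewrite /outward; case: ifP.
rewrite -add1n; apply: ca_run_trans (IH _) _ => [j Hj|]; first by apply: Hm; lia.
have := ca_run1 (A := A) mono _
  (act_away (side _) (ora (outward (reg_of (prog q)) m)) (Hm m (leqnn _))).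
rewrite updZ_id (_ : (_ + moveZ _ = outward (reg_of (prog q)) (1 + m))%Z).
  by apply=> /Aq q0 [].
by rewrite /outward; case: ifP => _ /=; lia.
Qed.

Lemma side_outward i j : side (outward i j.+1) = Some (i == 0).
Proof. by rewrite /side /outward; case: (i == 0); zcases. Qed.

Lemma walk_back A i (q : Q) L m : monotone L ->
  ca_run A m.+1 (encode (outward i m) (Back, q) L) (encode 0 (Out, q) L).
Proof.
move=> mono; elim: m => [|m IH].
  have -> : outward i 0 = 0%Z by rewrite /outward; case: ifP.
  have := @ca_run1 A 0%Z (Back, q) L _ _ _ mono _ erefl.
  by rewrite /= updZ_id; apply.
rewrite -addn1; apply: ca_run_trans IH.
have E : act (side (outward i m.+1)) (Back, q) (L (outward i m.+1)) (ora (outward i m.+1)) =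
    (L (outward i m.+1), Some (i != 0), (Back, q)) by rewrite side_outward.
have := ca_run1 (A := A) mono _ E; rewrite updZ_id.
rewrite (_ : (_ + _ = outward i m)%Z); first by apply.
by rewrite /outward; case: (i == 0); rewrite [moveZ _]/=; lia.
Qed.

Lemma mstep_bounded o s : s.1 <= K -> (mstep o prog s).1 <= K.
Proof.
move=> _; rewrite /mstep; have := prog_bounded s.1.
case: (prog s.1) => [i j []|i j0 j1 []|i j0 j1 []] //= _ Hj0 Hj1; first by case: (s.2 i).
by case: ifP.
Qed.

Definition encode_state (s : mstate) : config (option (cell)) :=
  encode 0 (Out, inord s.1) (digits_of_regs s.2).

Let o (j : nat) : bool := ora (- Z.of_nat j).

Lemma updZ_regs rho i m v : i <= K -> rho i = m + ~~ v ->
  updZ (digits_of_regs rho) (outward i m)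
    (set_digit (digits_of_regs rho (outward i m)) (inord i) v) =
  digits_of_regs (upd rho i (m + v)).
Proof.
move=> Hi Hm; apply: functional_extensionality => z; apply/ffunP => j.
rewrite /updZ /upd ffunE; case: (Z.eqb_spec z (outward i m)) => [->|zi].
  rewrite /set_digit !ffunE -(inj_eq val_inj) /= inordK //.
  case: eqVneq => [ji|//].
  have -> : (j == ord0) = (i == 0) by rewrite -val_eqE /= ji.
  by rewrite /outward; case: (i == 0); case: v {Hm}; zcases.
rewrite ffunE; case: (eqVneq (val j) i) => [/= ji|//].
have -> : (j == ord0) = (i == 0) by rewrite -val_eqE /= ji.
by move: zi; rewrite ji Hm /outward; case: (i == 0) => zi; case: v {Hm} => /=; zcases.
Qed.

Lemma outward0 i : outward i 0 = 0%Z.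
Proof. by rewrite /outward; case: ifP. Qed.

Lemma outwardS i m : (outward i m.+1 + moveZ (Some (i != 0)%N) = outward i m)%Z.
Proof. by rewrite /outward; case: (i == 0); rewrite [moveZ _]/=; lia. Qed.

Lemma ca_run_stay A h hd (L : Z -> digits) l hd' L' :
  monotone L -> (A -> hd <> (Out, ord0)) ->
  act (side h) hd (L h) (ora h) = (l, None, hd') -> updZ L h l = L' ->
  ca_run A 1 (encode h hd L) (encode h hd' L').
Proof.
by move=> mono Ahd E <-; have := ca_run1 mono Ahd E; rewrite [moveZ _]/= Z.add_0_r.
Qed.

Lemma sim_step s : s.1 <= K -> exists m, 0 < m /\
  ca_run (s.1 <> 0) m (encode_state s) (encode_state (mstep o prog s)).
Proof.
case: s => q rho /= Hq; set A := _ <> 0; rewrite /mstep /encode_state /=.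
set D := digits_of_regs rho.
have mono : monotone D := monotone_regs rho.
have progq : prog (inord q : Q) = prog q by rewrite inordK.
have Aq : A -> inord q <> ord0 :> Q by move=> q0 /eqP; rewrite inord_eq0 // => /eqP.
have AOut : A -> (Out, inord q) <> (Out, ord0) :> head by move=> /Aq q0 [].
have Hout : ca_run A (rho (reg_of (prog q))) (encode 0 (Out, inord q) D)
    (encode (outward (reg_of (prog q)) (rho (reg_of (prog q)))) (Out, inord q) D).
  rewrite -progq; apply: walk_out => // j; rewrite progq => Hj.
  by rewrite digits_outward //; apply: reg_bounded.
have Hend : D (outward (reg_of (prog q)) (rho (reg_of (prog q)))) (inord (reg_of (prog q))) = false.
  by rewrite digits_outward ?ltnn //; apply: reg_bounded.
have := prog_bounded q; move: progq Hout Hend.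
case Eq: (prog q) => [i j|i j0 j1|i j0 j1] /= progq Hout Hend.
- move=> [Hi Hj]; exists ((rho i).+1 + (1 + rho i)); split=> //.
  apply: ca_run_trans; last exact: (@walk_back A i _ _ _ (monotone_regs _)).
  apply: ca_run_trans Hout _; apply: ca_run_stay => //.
    by rewrite /act progq Hend.
  by rewrite updZ_regs ?addn0 ?addn1.
- move=> [Hi Hj0 Hj1]; case Ei: (rho i) => [|c]; rewrite Ei in Hout Hend.
    exists (1 + (1 + 0)); split=> //.
    apply: ca_run_trans; last exact: (@walk_back A i _ _ _ mono).
    apply: ca_run_trans Hout _; apply: ca_run_stay (updZ_id _ _) => //.
    by rewrite /act progq Hend outward0.
  exists (c.+1 + (1 + (1 + c.+1))); split=> //.
  apply: ca_run_trans; last exact: (@walk_back A i _ _ _ (monotone_regs _)).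
  apply: (@ca_run_trans _ _ _ _ (encode (outward i c) (Clr, inord q) D)).
    apply: ca_run_trans Hout _.
    have E : act (side (outward i c.+1)) (Out, inord q) (D (outward i c.+1))
        (ora (outward i c.+1)) = (D (outward i c.+1), Some (i != 0), (Clr, inord q)).
      by rewrite /act progq Hend side_outward.
    by have := ca_run1 mono AOut E; rewrite updZ_id outwardS.
  apply: ca_run_stay => //; first by rewrite /act progq.
  by rewrite updZ_regs ?addn0 ?addn1.
- move=> [Hi Hj0 Hj1]; exists ((rho i).+1 + (1 + rho i)); split=> //.
  apply: ca_run_trans; last exact: (@walk_back A i _ _ _ mono).
  apply: ca_run_trans Hout _; apply: ca_run_stay (updZ_id _ _) => //.
  rewrite /act progq Hend; congr (_, _, (_, inord (if _ then _ else _))).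
  by rewrite /o /outward; case: (i == 0).
Qed.
End Automaton.

(** * Recurrence of the displayed word *)

Section Recurrence.
Variables (K : nat) (prog : nat -> instr).
Notation Q := 'I_K.+1.
Notation cell := (cell K).
Notation f := (@automaton K prog).
Hypothesis prog_bounded : forall q,
  match prog q with
  | INC i j => i <= K /\ j <= K
  | DEC i j0 j1 | QRY i j0 j1 => [/\ i <= K, j0 <= K & j1 <= K]
  end.
Hypothesis prog0 : prog 0 = INC 2 1.

Lemma dead_spreads x z t y : x z = None -> (Z.abs (y - z) <= Z.of_nat t)%Z ->
  iter t f x y = None.
Proof.
move=> xz; elim: t y => [|t IH] y Hy /=; first by have -> : y = z by lia.
have [w Hw Hyw] : exists2 w, (Z.abs (w - z) <= Z.of_nat t)%Z &
    (w = y - 1 \/ w = y \/ w = y + 1)%Z.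
  by case: (Z.ltb_spec y z) => ?; [exists (y + 1)%Z | case: (Z.ltb_spec z y) => ?;
    [exists (y - 1)%Z | exists y]]; lia.
have := IH _ Hw; rewrite /automaton /local_map /rule.
case: Hyw => [->|[->|->]] -> //.
  by case: (iter t f x (y - 1)%Z).
by case: (iter t f x (y - 1)%Z) => //; case: (iter t f x y).
Qed.

Definition recurrent (x : config (option cell)) : Prop :=
  forall T, exists t, T <= t /\ displays (iter t f x).

Lemma recurrent_iter x t : recurrent x -> recurrent (iter t f x).
Proof.
move=> rec T; have [t' [Ht' D]] := rec (T + t); exists (t' - t); split; first lia.
by rewrite -iterD subnK //; lia.
Qed.

Lemma recurrent_alive x : recurrent x -> forall z, exists c c',
  [/\ x z = Some c, x (z + 1)%Z = Some c' & ok c c'].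
Proof.
move=> rec z.
have alive t y : iter t f x y <> None.
  move=> Hy; have [t' [Ht' [c [Ec _]]]] := rec (t + Z.to_nat (Z.abs y)).
  have := @dead_spreads _ _ (t' - t) 0%Z Hy.
  by rewrite -iterD subnK ?Ec; [move=> H; have: Some c = None by apply: H; lia | lia].
have := alive 1 z; rewrite /= /automaton /local_map /rule.
case: (x (z - 1)%Z) => // a; case Eb: (x z) => [b|] //; case Ec: (x (z + 1)%Z) => [c|] //.
by case: ifP => // /andP[_ Hok] _; exists b, c.
Qed.

Definition display_cell (n : nat) (z : Z) : option cell :=
  encode (fun=> false) 0 (Out, ord0) (digits_of_regs K (round_regs n.+1 0 1 0)) z.
Definition display_word (n : nat) : seq (option cell) :=
  [seq display_cell n (Z.of_nat i) | i <- iota 0 n.+2].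

Lemma up_closed (a : Z -> bool) z z' : (forall y, a y -> a (y + 1)%Z) -> a z -> (z <= z')%Z -> a z'.
Proof.
move=> up az Hz; have [d ->] : exists d, (z' = z + Z.of_nat d)%Z.
  by exists (Z.to_nat (z' - z)); lia.
elim: d {Hz} => [|d IH]; first by rewrite Z.add_0_r.
have -> : (z + Z.of_nat d.+1 = z + Z.of_nat d + 1)%Z by lia.
exact: up.
Qed.

Lemma Z_both_ind (P : Z -> Prop) : P 0%Z -> (forall z, (0 <= z)%Z -> P z -> P (z + 1)%Z) ->
  (forall z, (z <= 0)%Z -> P z -> P (z - 1)%Z) -> forall z, P z.
Proof.
move=> P0 Pup Pdown z.
have Hup d : P (Z.of_nat d).
  elim: d => // d IH; have -> : (Z.of_nat d.+1 = Z.of_nat d + 1)%Z by lia.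
  by apply: Pup => //; lia.
have Hdown d : P (- Z.of_nat d)%Z.
  elim: d => // d IH; have -> : (- Z.of_nat d.+1 = - Z.of_nat d - 1)%Z by lia.
  by apply: Pdown => //; lia.
case: (Z.leb_spec 0 z) => Hz.
  by have -> : z = Z.of_nat (Z.to_nat z) by lia.
by have -> : z = (- Z.of_nat (Z.to_nat (- z)))%Z by lia.
Qed.

Lemma display_decode n x : recurrent x ->
  (forall i, i < n.+2 -> x (Z.of_nat i) = display_cell n (Z.of_nat i)) ->
  exists ora L, [/\ x = encode ora 0 (Out, ord0) L, monotone L &
    (forall z, L z (inord 2)) \/ exists b, L = digits_of_regs K (round_regs n.+1 0 b.+1 0)].
Proof.
move=> /recurrent_alive alive xn.
have [c0 _] := alive 0%Z; pose c z := odflt c0 (x z).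
have xc z : x z = Some (c z) by have [a [b [E _ _]]] := alive z; rewrite /c E.
have okc z : ok (c z) (c (z + 1)%Z).
  by have [a [b [E1 E2 H]]] := alive z; rewrite /c E1 E2.
have sideP z : side_of (c z) = side z.
  elim/Z_both_ind: z => [|z Hz IH|z Hz IH].
  - by have := xn 0 (ltn0Sn _); rewrite xc => -[->].
  - have /andP[+ _] := okc z; rewrite IH /side.
    by case: (side_of _) => [[]|]; zcases.
  - have /andP[+ _] := okc (z - 1)%Z; have -> : (z - 1 + 1 = z)%Z by lia.
    by rewrite IH /side; case: (side_of _) => [[]|]; zcases.
have headP z : head_of (c z) = if (z =? 0)%Z then inr (Out, ord0) else inl (z <? 0)%Z.
  elim/Z_both_ind: z => [|z Hz IH|z Hz IH].
  - by have := xn 0 (ltn0Sn _); rewrite xc => -[->].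
  - have /and3P[_ + _] := okc z; rewrite IH.
    by case: (head_of _) => [[]|?]; zcases.
  - have /and3P[_ + _] := okc (z - 1)%Z; have -> : (z - 1 + 1 = z)%Z by lia.
    by rewrite IH; case: (head_of _) => [[]|?]; zcases.
pose L z := digits_of (c z).
have mono : monotone L by move=> z; have /and3P[_ _ ?] := okc z.
exists (fun z => (c z).2), L; split=> //.
  apply: functional_extensionality => z; rewrite xc /encode -sideP -headP /L.
  by case: (c z) => [[[]]].
have Ln i (j : Q) : i < n.+2 -> L (Z.of_nat i) j =
    digits_of_regs K (round_regs n.+1 0 1 0) (Z.of_nat i) j.
  by move=> Hi; have := xn i Hi; rewrite xc /L => -[->].
have mono0 z : ~~ L z ord0 -> ~~ L (z + 1)%Z ord0.
  by have /forallP/(_ ord0) := mono z; rewrite eqxx => /implyP; apply: contra.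
have monoS z (j : Q) : j != ord0 -> L z j -> L (z + 1)%Z j.
  by move=> /negbTE Hj; have /forallP/(_ j) := mono z; rewrite Hj => /implyP.
have K2 : 2 <= K by have := prog_bounded 0; rewrite prog0 => -[].
have val2 : (inord 2 : Q) = 2 :> nat by rewrite inordK.
have ne2 : (inord 2 : Q) != ord0 by rewrite -val_eqE /= val2.
case: (classic (forall z, L z (inord 2))) => [|/not_all_ex_not[z Hz]]; [by left | right].
have L20 : L 0%Z (inord 2) by rewrite (Ln 0) // ffunE (negbTE ne2) val2.
have [b Hb bmin] : exists2 b, ~~ L (- Z.of_nat b.+1)%Z (inord 2) & L (- Z.of_nat b)%Z (inord 2).
  have exb : exists b, ~~ L (- Z.of_nat b)%Z (inord 2).
    exists (Z.to_nat (- z)); apply/negP => /(up_closed (a := fun z => L z (inord 2))) H.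
    apply: Hz; case: (Z.leb_spec z 0) => Hz0.
      have -> : z = (- Z.of_nat (Z.to_nat (- z)))%Z by lia.
      by apply: H => [y|]; [apply: monoS | lia].
    by apply: (up_closed (a := fun z => L z (inord 2))) L20 _ => [y|]; [apply: monoS | lia].
  case: (ex_minnP exb) => -[|b] Hb bmin; first by rewrite L20 in Hb.
  by exists b => //; apply/negP => /negP /bmin; rewrite ltnn.
exists b; apply: functional_extensionality => y; apply/ffunP => j; rewrite ffunE.
case: eqVneq => [->|j0].
  rewrite [round_regs _ _ _ _ _]/=; case: Z.ltb_spec => Hy.
    apply/negPn/negP => /(up_closed mono0)/(_ (ltac:(lia) : (y <= Z.of_nat n)%Z)).
    by rewrite (Ln n) // ffunE eqxx [round_regs _ _ _ _ _]/=; zcases.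
  apply/negbTE/(up_closed mono0 _ Hy).
  by rewrite (Ln n.+1) // ffunE eqxx [round_regs _ _ _ _ _]/=; zcases.
have up := up_closed (fun y => @monoS y j j0).
case: (eqVneq j (inord 2)) => [Ej|j2].
  rewrite Ej val2 [round_regs _ _ _ _ _]/=; rewrite Ej in up; case: Z.ltb_spec => Hy.
    by apply: up bmin _; lia.
  by apply/negP => /up H; move/negP: Hb; apply; apply: H; lia.
have regs0 b' : round_regs n.+1 0 b' 0 j = 0.
  move: j0 j2; rewrite -!val_eqE /= val2; case: (val j) => [|[|[|[|]]]] //.
rewrite regs0; case: Z.ltb_spec => Hy.
  apply: up (_ : L 1%Z j) _; last lia.
  by rewrite (Ln 1) // ffunE (negbTE j0) regs0.
apply/negP => /up H; have : L 0%Z j by apply: H; lia.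
by rewrite (Ln 0) // ffunE (negbTE j0) regs0.
Qed.
Section Simulation.
Variable ora : Z -> bool.
Let o (j : nat) : bool := ora (- Z.of_nat j).
Notation encode_state := (@encode_state K ora).

Lemma stalls_displays s : s.1 <= K -> stalls o prog s ->
  exists T, forall t, T <= t -> ~ displays (iter t f (encode_state s)).
Proof.
have avoid s' t : s'.1 <= K -> (forall k, (iter k (mstep o prog) s').1 <> 0) ->
    ~ displays (iter t f (encode_state s')).
  have [d] := ubnP t; elim: d t s' => // d IH t s' Hd Hs Hk.
  have [m [m_gt0 [E Hm]]] := sim_step ora prog_bounded Hs.
  case: (ltnP t m) => [|le_t]; first exact: Hm (Hk 0) t.
  rewrite -(subnK le_t) iterD E; apply: IH => [||k]; first lia.
    exact: mstep_bounded.
  by have := Hk k.+1; rewrite iterSr.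
move=> + [k]; elim: k s => [|k IH] s Hs Hk.
  by exists 0 => t _; apply: avoid => // j; apply: Hk.
have [m [m_gt0 [E _]]] := sim_step ora prog_bounded Hs.
have [||T HT] := IH (mstep o prog s); first exact: mstep_bounded.
  by move=> j Hj; rewrite -iterSr; apply: Hk.
exists (T + m) => t Ht; rewrite -(subnK (_ : m <= t)); last lia.
by rewrite iterD E; apply: HT; lia.
Qed.

Lemma sim_iter s k : s.1 <= K ->
  exists2 t, k <= t & iter t f (encode_state s) = encode_state (iter k (mstep o prog) s).
Proof.
elim: k s => [|k IH] s Hs; first by exists 0.
have [m [m_gt0 [E _]]] := sim_step ora prog_bounded Hs.
have [t le_t Et] := IH (mstep o prog s) (mstep_bounded prog_bounded o Hs).
by exists (t + m); [lia | rewrite iterD E Et -iterSr].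
Qed.
End Simulation.

Lemma display_language n : language (asymptotic_set f) (display_word n) ->
  exists ora b, recurrent (@encode_state K ora (display_state n.+1 b.+1)).
Proof.
move=> [y [[x xy] yn]].
have yn' i : i < n.+2 -> y (Z.of_nat i) = display_cell n (Z.of_nat i).
  move=> Hi; have /(congr1 (nth None ^~ i)) := yn.
  by rewrite size_map size_iota !(nth_map 0) ?size_iota // nth_iota.
have often T : exists t, T <= t /\
    forall i, i < n.+2 -> iter t f x (Z.of_nat i) = display_cell n (Z.of_nat i).
  have [t [Ht agr]] := xy T n.+2; exists t; split=> // i Hi.
  by rewrite agr ?yn' //; lia.
have rec : recurrent x.
  move=> T; have [t [Ht H]] := often T; exists t; split=> //.
  by eexists; rewrite (H 0).
have [t [_ Ht]] := often 0.
have [ora [L [E mono]]] := display_decode (recurrent_iter t rec) Ht.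
have := recurrent_iter t rec; rewrite E => recE.
case=> [full|[b EL]]; last first.
  exists ora, b; move: recE; rewrite EL /encode_state /display_state /=.
  by rewrite (_ : inord 0 = ord0) //; apply: val_inj; rewrite /= inordK.
have [m [Hm]] := recE 1.
have [||Em _] := @walk_out K prog ora False ord0 L m mono => //.
  by move=> j _; rewrite prog0; apply: full.
rewrite Em prog0 /encode => -[c []].
have -> : (0 =? outward (reg_of (INC 2 1)) m)%Z = false.
  by apply/Z.eqb_neq; change (0 <> - Z.of_nat m)%Z; lia.
by move=> [<-].
Qed.

Lemma language_display (C : nat -> bool) n :
  (forall b, exists2 m, b <= m &
     iter m (mstep (fun j => if j is j'.+1 then C j' else false) prog) (display_state n.+1 1)
       = display_state n.+1 b.+1) ->
  language (asymptotic_set f) (display_word n).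
Proof.
pose ora z := if (z <? 0)%Z then C (Z.to_nat (- z)).-1 else false.
have -> : (fun j => if j is j'.+1 then C j' else false) = (fun j => ora (- Z.of_nat j)%Z).
  apply: functional_extensionality => -[|j] //; rewrite /ora.
  by case: Z.ltb_spec => ?; [congr C | ]; lia.
move=> H; pose Lb b := digits_of_regs K (round_regs n.+1 0 b 0).
pose L z : digits K := [ffun i : Q => (val i == 2) || Lb 0 z i].
have LbE b z (i : Q) : Lb b z i = if val i == 2 then (- z <? Z.of_nat b)%Z else Lb 0 z i.
  rewrite !ffunE -!(inj_eq val_inj) /=; case: i => [[|[|[|[|i]]]] Hi] //=.
exists (encode ora 0 (Out, ord0) L); split.
  exists (@encode_state K ora (display_state n.+1 1)) => T r.
  have [m Hm Em] := H (T + r).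
  have [t Ht Et] := sim_iter ora m (leq0n K : (display_state n.+1 1).1 <= K).
  exists t; split; first lia.
  move=> i Hi; rewrite Et Em /encode_state /display_state /= /encode.
  rewrite (_ : inord 0 = ord0); last by apply: val_inj; rewrite /= inordK.
  congr (Some (_, _, _, _)); apply/ffunP => j; rewrite -/(Lb _) LbE [L _ j]ffunE.
  by case: eqP => //= _; zcases.
apply: (@eq_from_nth _ None); first by rewrite !size_map !size_iota.
move=> i; rewrite size_map size_iota => Hi.
rewrite !(nth_map 0) ?size_map ?size_iota // !nth_iota // add0n /display_cell /encode.
have -> : ora (Z.of_nat i) = false by rewrite /ora; zcases.
congr (Some (_, _, _, _)); apply/ffunP => j; rewrite -/(Lb _) LbE [L _ j]ffunE.
by case: eqP => //= _; zcases.
Qed.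
End Recurrence.

Lemma prog_bound (s : seq instr) : exists K, forall q,
  match nth (INC 0 0) s q with
  | INC i j => i <= K /\ j <= K
  | DEC i j0 j1 | QRY i j0 j1 => [/\ i <= K, j0 <= K & j1 <= K]
  end.
Proof.
elim: s => [|x s [K HK]]; first by exists 0 => q; rewrite nth_nil.
pose b := match x with
  | INC i j => i + j
  | DEC i j0 j1 | QRY i j0 j1 => i + j0 + j1
  end.
exists (K + b) => -[|q] /=; first by rewrite /b; case: x {b} => *; split; lia.
by have := HK q; case: (nth _ _ _) => [? ?|? ? ?|? ? ?] [] *; split; lia.
Qed.

Section DisplayWord.
Variable K : nat.

Lemma display_wordE n : display_word K n =
  display_cell K 0 0 :: rcons (nseq n (display_cell K 1 1)) (display_cell K 0 1).
Proof.
apply: (@eq_from_nth _ None) => [|i]; rewrite size_map size_iota.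
  by rewrite /= size_rcons size_nseq.
move=> Hi; rewrite (nth_map 0) ?size_iota // nth_iota // add0n.
case: i Hi => [|i] Hi.
  congr (Some (_, _, _, _)); apply/ffunP => j; rewrite !ffunE.
  by case: j => [[|[|[|j]]] ?] //.
rewrite [RHS]/= nth_rcons size_nseq nth_nseq.
have [lt_in|le_ni] := ltnP i n; last have -> : i = n by lia.
  rewrite /display_cell /encode; congr (Some (_, _, _, _)).
  by apply/ffunP => j; rewrite !ffunE; case: j => [[|[|[|j]]] ?] //=; zcases.
rewrite eqxx /display_cell /encode; congr (Some (_, _, _, _)).
by apply/ffunP => j; rewrite !ffunE; case: j => [[|[|[|j]]] ?] //=; zcases.
Qed.

Lemma computable_display : computable (fun n => word_code (display_word K n)).
Proof.
apply: computable_orec.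
pose r c := (enum_rank (display_cell K c.1 c.2)).+1.
pose k := #|{: option (cell K)}|.
apply: (@orec_ext _ (fun _ v => r (0, 0%Z) + k * nat_rect (fun=> nat) (r (0, 1%Z))
    (fun _ a => r (1, 1%Z) + k * a) (nth 0 v 0))) => [_ v _|].
  rewrite display_wordE /=; congr (_ + _ * _); elim: (nth 0 v 0) => /= [|n ->] //.
  by rewrite muln0 addn0.
apply: orec_add; first exact: orec_const.
apply: orec_mul; first exact: orec_const.
apply: (orec_rect (S := fun _ _ _ a => r (1, 1%Z) + k * a)); [exact: orec_nth|exact: orec_const|].
by apply: orec_add; [|apply: orec_mul; [|exact: orec_nth]]; exact: orec_const.
Qed.
End DisplayWord.

Lemma Sigma11_hard P : Sigma11 P -> exists (K : nat) (prog : nat -> instr),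
  many_one_reducible P (languageN (asymptotic_set (@automaton K prog))).
Proof.
move=> [e [e_total PE]].
have [h Hh] : orec 3 (fun _ v => (nth 0 v 2).-1) by apply/orec_pred/orec_nth.
pose e' := RComp e [:: RProj 0; RProj 1; h].
have e'E C m l n r : reval C e [:: m; l; n.-1] r -> reval C e' [:: m; l; n] r.
  apply: ev_comp; do 2! [constructor; first by constructor].
  by constructor; [apply: Hh | constructor].
have e'_total C m l w : exists r, reval C e' [:: m; l; w] r.
  by have [r Hr] := e_total C m l w.-1; exists r; apply: e'E.
have [K HK] := prog_bound (search e').
exists K, (search_prog e'), (fun n => word_code (display_word K n)).
split; first exact: computable_display.
move=> n; split=> [/PE[C HC]|[w [/word_code_inj -> /(display_language HK erefl)[ora [b rec]]]]].
  exists (display_word K n); split=> //.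
  apply: (language_display HK (C := C)).
  apply: (display_unbounded e'_total) => [//|a].
  by have [l Hl] := HC a; exists l; apply: e'E.
apply/PE; exists (fun j => ora (- Z.of_nat j.+1)%Z); apply: NNPP => HC.
have [|T HT] := stalls_displays HK (ora := ora) (leq0n K : (display_state n.+1 b.+1).1 <= K).
  apply: (display_stalls e'_total (C := fun j => ora (- Z.of_nat j.+1)%Z)) => // H.
  apply: HC => a; have [l Hl] := H a; exists l.
  have [r Hr] := e_total (fun j => ora (- Z.of_nat j.+1)%Z) a l n.
  by rewrite (reval_fun Hl (e'E _ _ _ n.+1 _ Hr)).
by have [t [/HT Ht /Ht]] := rec T.
Qed.

Theorem theorem1 :
  (forall P : nat -> Prop, Sigma11 P ->
     exists (S : finType) (f : config S -> config S),
       0 < #|S| /\ cellular_automaton f /\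
       many_one_reducible P (languageN (asymptotic_set f))) /\
  (exists (S : finType) (f : config S -> config S),
       0 < #|S| /\ cellular_automaton f /\
       Sigma11_complete (languageN (asymptotic_set f))).
Proof.
have card_gt0 K : 0 < #|{: option (cell K)}| by apply/card_gt0P; exists None.
split=> [P /Sigma11_hard[K [prog red]]|].
  exists (option (cell K)), (@automaton K prog); split; first exact: card_gt0.
  by split=> //; apply: local_map_ca.
have red_code K prog : many_one_reducible
    (languageN (asymptotic_set (@automaton K prog))) asymptotic_code.
  exists (rule_word None (@rule K prog)); split; last exact: languageN_asymptotic_code.
  apply/computable_orec/orec_pair; first exact: orec_const.
  by apply: orec_pair; [apply: orec_const | apply: orec_nth].
have [K [prog red]] := Sigma11_hard Sigma11_asymptotic_code.
exists (option (cell K)), (@automaton K prog); split; first exact: card_gt0.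
split; first exact: local_map_ca.
split; first exact: Sigma11_reducible (red_code K prog) Sigma11_asymptotic_code.
move=> T /Sigma11_hard[K' [prog' redT]].
exact: many_one_trans redT (many_one_trans (red_code K' prog') red).
Qed.
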